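(* For every $n\geq 12$ there exists a connected $\mathbb{C}$-realizable matroid $\mathsf{Q}$ of rank $3$ on $n$ elements whose realization space $\mathcal{R}(\mathsf{Q};\mathbb{C})$ has nodal singularities.
   Context: Let $\mathbb{F}$ be a field and let $\mathsf{Q}$ be a matroid of rank $d$ on $[n]=\{1,\dots,n\}$ with set of bases $\mathcal{B}(\mathsf{Q})\subset\binom{[n]}{d}$. $\mathsf{Q}$ is $\mathbb{F}$-realizable if there is a $d$-dimensional subspace $V\subset\mathbb{F}^n$ whose Plücker coordinates satisfy $p_\lambda(V)\neq 0$ if and only if $\lambda\in\mathcal{B}(\mathsf{Q})$. A matroid is connected if it is not a nontrivial direct sum. The matroid stratum $\mathrm{Gr}(\mathsf{Q};\mathbb{F})$ is the locally closed subscheme of the Grassmannian $\mathrm{Gr}(d,n;\mathbb{F})$ (of $d$-dimensional subspaces of $\mathbb{F}^n$, in its Plücker embedding) where $p_\lambda=0$ for $\lambda\notin\mathcal{B}(\mathsf{Q})$ and $p_\lambda$ is invertible for $\lambda\in\mathcal{B}(\mathsf{Q})$. Explicitly, suppose after relabelling that $[d]\in\mathcal{B}(\mathsf{Q})$. Let $A=[\,I_d\mid (x_{ij})\,]$ be the $d\times n$ matrix where $x_{ij}$ ($1\le i\le d$, $1\le j\le n-d$) is a variable if $([d]\setminus i)\cup\{d+j\}\in\mathcal{B}(\mathsf{Q})$ and is $0$ otherwise. Let $B_{\mathsf{Q}}$ be the polynomial ring over $\mathbb{F}$ in these variables, and let $A_\lambda$ be the maximal minor on columns $\lambda$. Let $I_{\mathsf{Q}}=\langle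 A_\lambda:\lambda\notin\mathcal{B}(\mathsf{Q})\rangle$ and let $U_{\mathsf{Q}}$ be the multiplicative semigroup generated by the $A_\lambda$ with $\lambda\in\mathcal{B}(\mathsf{Q})$. Then $\mathrm{Gr}(\mathsf{Q};\mathbb{F})=\mathrm{Spec}(S_{\mathsf{Q}})$ with $S_{\mathsf{Q}}=U_{\mathsf{Q}}^{-1}B_{\mathsf{Q}}/I_{\mathsf{Q}}$. For $\mathsf{Q}$ connected, the torus $T=(\mathbb{F}^* )^n/\mathbb{F}^*$ acts freely on $\mathrm{Gr}(\mathsf{Q};\mathbb{F})$ by scaling the coordinates of $\mathbb{F}^n$, and the realization space is the affine scheme $\mathcal{R}(\mathsf{Q};\mathbb{F})=\mathrm{Gr}(\mathsf{Q};\mathbb{F})/T=\mathrm{Spec}(S_{\mathsf{Q}}^{T})$. It parameterizes hyperplane arrangements $(h_1,\dots,h_n)$ in $\mathbb{P}^{d-1}$ such that $\bigcap_{i\in\lambda}h_i=\emptyset$ if and only if $\lambda\in\mathcal{B}(\mathsf{Q})$ (for $\lambda\in\binom{[n]}{d}$), up to the action of $\mathrm{PGL}_d(\mathbb{F})$. A scheme $X$ of finite type over $\mathbb{C}$ has nodal singularities if it has closed points with the singularity type (up to smooth morphisms) of the plane curve node $uv=0$ at the origin, i.e. closed points whose completed local ring is isomorphic to $\mathbb{C}[[u,v,z_1,\dots,z_m]]/(uv)$ for some $m\geq 0$. *)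

(* Defs.v *)
From HB Require Import structures.
From mathcomp Require Import all_boot all_fingroup all_algebra.
From mathcomp Require Import generic_quotient ring_quotient ring.
From mathcomp Require Import boolp functions reals complex mpoly.

Set Implicit Arguments.
Unset Strict Implicit.
Unset Printing Implicit Defensive.

Import GRing.Theory.

Local Open Scope ring_scope.
Local Open Scope quotient_scope.

Section Spans.
Variable R : comPzRingType.

Definition ideal_span (X : R -> Prop) (a : R) : Prop :=
  exists s : seq (R * R),
    (forall p, p \in s -> X p.2) /\ a = \sum_(p <- s) p.1 * p.2.

Definition monoid_span (X : R -> Prop) (a : R) : Prop :=
  exists s : seq R, (forall x, x \in s -> X x) /\ a = \prod_(x <- s) x.

Definition ideal_pow (I : R -> Prop) (k : nat) : R -> Prop :=
  ideal_span (fun a => exists s : seq R,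
    [/\ size s = k, forall x, x \in s -> I x & a = \prod_(x <- s) x]).

Definition is_ideal (I : R -> Prop) : Prop :=
  [/\ I 0, forall x y, I x -> I y -> I (x + y) & forall a x, I x -> I (a * x)].

Definition maximal_ideal (I : R -> Prop) : Prop :=
  [/\ is_ideal I, ~ I 1 &
      forall J, is_ideal J -> (forall x, I x -> J x) -> ~ J 1 ->
      forall x, J x -> I x].

Lemma ideal_span_gen X x : X x -> ideal_span X x.
Proof.
move=> Xx; exists [:: (1, x)]; split; last by rewrite big_seq1 mul1r.
by move=> p; rewrite inE => /eqP ->.
Qed.

Lemma ideal_span_is_ideal X : is_ideal (ideal_span X).
Proof.
split=> [|x y [s [sX ->]] [t [tX ->]]|a x [s [sX ->]]].
- by exists [::]; rewrite big_nil.
- exists (s ++ t); rewrite big_cat; split=> // p.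
  by rewrite mem_cat => /orP[/sX|/tX].
- exists [seq (a * p.1, p.2) | p <- s]; split.
    by move=> _ /mapP[p /sX ? ->].
  by rewrite big_map mulr_sumr; apply: eq_bigr => p _ /=; rewrite mulrA.
Qed.

Lemma monoid_span_gen X x : X x -> monoid_span X x.
Proof.
move=> Xx; exists [:: x]; split; last by rewrite big_seq1.
by move=> p; rewrite inE => /eqP ->.
Qed.

Lemma monoid_span1 X : monoid_span X 1.
Proof. by exists [::]; rewrite big_nil. Qed.

Lemma monoid_spanM X x y :
  monoid_span X x -> monoid_span X y -> monoid_span X (x * y).
Proof.
move=> [s [sX ->]] [t [tX ->]]; exists (s ++ t); rewrite big_cat; split=> // p.
by rewrite mem_cat => /orP[/sX|/tX].
Qed.

End Spans.

(* R / <X>, with <X> the ideal generated by X. The library builds the quotient *)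
(* of a zmodType by an arbitrary subgroup, but its ring structure only for     *)
(* proper ideals of nonzero rings.                                             *)
Section IdealQuotient.
Variables (R : comPzRingType) (X : R -> Prop).

Definition ideal_spanb : {pred R} := fun a => `[< ideal_span X a >].

Lemma ideal_spanb_zmod_closed : zmod_closed ideal_spanb.
Proof.
have [i0 iD iM] := ideal_span_is_ideal X.
split=> [|x y /asboolP Ix /asboolP Iy]; apply/asboolP => //.
by rewrite -mulN1r; apply: iD => //; apply: iM.
Qed.
HB.instance Definition _ :=
  GRing.isZmodClosed.Build R ideal_spanb ideal_spanb_zmod_closed.

Definition quotient : Type := Quotient.quot ideal_spanb.
HB.instance Definition _ := GRing.Zmodule.on quotient.

Definition quot_pi (a : R) : quotient := \pi_(Quotient.quot ideal_spanb) a.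

Lemma quot_piP (q : quotient) : exists a, q = quot_pi a.
Proof. by exists (repr (q : Quotient.quot ideal_spanb)); rewrite /quot_pi reprK. Qed.

Lemma quot_pi_eq a b : quot_pi a = quot_pi b <-> ideal_span X (a - b).
Proof.
rewrite /quot_pi; split=> [/eqP|h].
  by rewrite -Quotient.idealrBE => /asboolP.
by apply/eqP; rewrite -Quotient.idealrBE; apply/asboolP.
Qed.

Lemma quot_pi_zmod_morphism : zmod_morphism quot_pi.
Proof. by move=> a b; rewrite /quot_pi; rewrite !piE. Qed.
HB.instance Definition _ :=
  GRing.isZmodMorphism.Build R quotient quot_pi quot_pi_zmod_morphism.

Definition quot_repr (q : quotient) : R :=
  repr (q : Quotient.quot ideal_spanb).

Lemma quot_reprK : cancel quot_repr quot_pi.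
Proof. by move=> q; rewrite /quot_pi reprK. Qed.

Definition quot_mul (p q : quotient) : quotient :=
  quot_pi (quot_repr p * quot_repr q).

Lemma quot_mulE a b : quot_mul (quot_pi a) (quot_pi b) = quot_pi (a * b).
Proof.
have [i0 iD iM] := ideal_span_is_ideal X.
apply/quot_pi_eq.
have /quot_pi_eq ha := quot_reprK (quot_pi a).
have /quot_pi_eq hb := quot_reprK (quot_pi b).
set a' := quot_repr _ in ha *; set b' := quot_repr _ in hb *.
have -> : a' * b' - a * b = b' * (a' - a) + a * (b' - b).
  by rewrite !mulrBr [b' * a']mulrC [b' * a]mulrC addrA subrK.
by apply: iD; apply: iM.
Qed.

Fact quot_mulA : associative quot_mul.
Proof.
move=> x y z; have [[[a ->] [b ->]] [c ->]] := (quot_piP x, quot_piP y, quot_piP z).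
by rewrite !quot_mulE mulrA.
Qed.
Fact quot_mulC : commutative quot_mul.
Proof.
move=> x y; have [[a ->] [b ->]] := (quot_piP x, quot_piP y).
by rewrite !quot_mulE mulrC.
Qed.
Fact quot_mul1 : left_id (quot_pi 1) quot_mul.
Proof. by move=> x; have [a ->] := quot_piP x; rewrite quot_mulE mul1r. Qed.
Fact quot_mulDl : left_distributive quot_mul +%R.
Proof.
move=> x y z; have [[[a ->] [b ->]] [c ->]] := (quot_piP x, quot_piP y, quot_piP z).
by rewrite -raddfD !quot_mulE mulrDl raddfD.
Qed.
HB.instance Definition _ := GRing.Zmodule_isComPzRing.Build quotient
  quot_mulA quot_mulC quot_mul1 quot_mulDl.

Lemma quot_pi_monoid_morphism : monoid_morphism quot_pi.
Proof. by split=> // a b; rewrite -quot_mulE. Qed.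
HB.instance Definition _ :=
  GRing.isMonoidMorphism.Build R quotient quot_pi quot_pi_monoid_morphism.

Section Lift.
Variables (A : comPzRingType) (f : {rmorphism R -> A}).

Definition quot_lift of (forall x, X x -> f x = 0) :=
  fun q : quotient => f (quot_repr q).

Hypothesis f0 : forall x, X x -> f x = 0.

Lemma quot_liftE a : quot_lift f0 (quot_pi a) = f a.
Proof.
have /quot_pi_eq [s [sX e]] := quot_reprK (quot_pi a).
apply/eqP; rewrite -subr_eq0 -rmorphB {}e rmorph_sum big_seq.
by rewrite big1 // => p /sX Xp; rewrite rmorphM (f0 Xp) mulr0.
Qed.

Lemma quot_lift_zmod_morphism : zmod_morphism (quot_lift f0).
Proof.
move=> x y; have [[a ->] [b ->]] := (quot_piP x, quot_piP y).
by rewrite -raddfB !quot_liftE raddfB.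
Qed.
Lemma quot_lift_monoid_morphism : monoid_morphism (quot_lift f0).
Proof.
split; first by rewrite -(rmorph1 quot_pi) quot_liftE rmorph1.
move=> x y; have [[a ->] [b ->]] := (quot_piP x, quot_piP y).
by rewrite -rmorphM !quot_liftE rmorphM.
Qed.
HB.instance Definition _ := GRing.isZmodMorphism.Build quotient A (quot_lift f0)
  quot_lift_zmod_morphism.
HB.instance Definition _ := GRing.isMonoidMorphism.Build quotient A (quot_lift f0)
  quot_lift_monoid_morphism.
End Lift.

End IdealQuotient.

(* Localization at the multiplicative set generated by S and 1. *)
Section Localization.
Variables (R : comPzRingType) (S : R -> Prop).

Definition denominator := {s : R | `[< monoid_span S s >]}.
Definition den_val (s : denominator) : R := proj1_sig s.
Arguments den_val : simpl never.

Definition fraction : Type := (R * denominator)%type.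
HB.instance Definition _ := Choice.on fraction.

Definition fraction_equiv (x y : fraction) : bool :=
  `[< exists2 u, monoid_span S u &
        u * (x.1 * den_val y.2) = u * (y.1 * den_val x.2) >].

Fact fraction_equiv_class : equiv_class_of fraction_equiv.
Proof.
split=> [x|x y|y x z].
- by apply/asboolP; exists 1 => //; apply: monoid_span1.
- by apply/asboolP/asboolP => -[u Su e]; exists u.
move=> /asboolP[u Su e] /asboolP[v Sv e']; apply/asboolP.
have /asboolP Sy := valP y.2.
exists (u * v * den_val y.2); first by do 2?apply: monoid_spanM.
transitivity (v * den_val z.2 * (u * (x.1 * den_val y.2))); first by ring.
rewrite e; transitivity (u * den_val x.2 * (v * (y.1 * den_val z.2))); first by ring.
by rewrite e'; ring.
Qed.
Canonical fraction_equiv_equiv := EquivRelPack fraction_equiv_class.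
Canonical fraction_equiv_enc := defaultEncModRel fraction_equiv.

Definition localization : Type := {eq_quot fraction_equiv}.
HB.instance Definition _ := Choice.on localization.

Definition loc_pi (x : fraction) : localization := \pi_{eq_quot fraction_equiv} x.
Definition loc_repr (q : localization) : fraction :=
  repr (q : {eq_quot fraction_equiv}).

Lemma loc_reprK : cancel loc_repr loc_pi.
Proof. by move=> q; rewrite /loc_pi reprK. Qed.

Lemma loc_piP q : exists x, q = loc_pi x.
Proof. by exists (loc_repr q); rewrite loc_reprK. Qed.

Lemma loc_pi_eq x y : loc_pi x = loc_pi y <->
  exists2 u, monoid_span S u & u * (x.1 * den_val y.2) = u * (y.1 * den_val x.2).
Proof.
rewrite /loc_pi; split=> [/eqP|h].
  by rewrite piE /= => /asboolP.
by apply/eqP; rewrite piE; apply/asboolP.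
Qed.

Definition den s (Ss : monoid_span S s) : denominator :=
  exist _ s (asboolT Ss).
Definition den1 : denominator := den (monoid_span1 S).
Definition denM (s t : denominator) : denominator :=
  den (monoid_spanM (asboolW (valP s)) (asboolW (valP t))).

Lemma den_valK s (Ss : monoid_span S s) : den_val (den Ss) = s.
Proof. by []. Qed.
Lemma den_val1 : den_val den1 = 1. Proof. by []. Qed.
Lemma den_valM s t : den_val (denM s t) = den_val s * den_val t.
Proof. by []. Qed.
Definition den_valE := (den_val1, den_valM, den_valK).

Definition loc_add (p q : localization) : localization :=
  let x := loc_repr p in let y := loc_repr q in
  loc_pi (x.1 * den_val y.2 + y.1 * den_val x.2, denM x.2 y.2).
Definition loc_opp (p : localization) : localization :=
  let x := loc_repr p in loc_pi (- x.1, x.2).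
Definition loc_mul (p q : localization) : localization :=
  let x := loc_repr p in let y := loc_repr q in
  loc_pi (x.1 * y.1, denM x.2 y.2).

Lemma loc_addE x y : loc_add (loc_pi x) (loc_pi y) =
  loc_pi (x.1 * den_val y.2 + y.1 * den_val x.2, denM x.2 y.2).
Proof.
rewrite /loc_add; apply/loc_pi_eq.
have /loc_pi_eq[u Su hx] := loc_reprK (loc_pi x).
have /loc_pi_eq[v Sv hy] := loc_reprK (loc_pi y).
set x' := loc_repr _ in hx *; set y' := loc_repr _ in hy *.
exists (u * v); first exact: monoid_spanM.
rewrite /= !den_valE.
transitivity (v * den_val y'.2 * den_val y.2 * (u * (x'.1 * den_val x.2))
  + u * den_val x'.2 * den_val x.2 * (v * (y'.1 * den_val y.2))); first by ring.
by rewrite hx hy; ring.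
Qed.

Lemma loc_oppE x : loc_opp (loc_pi x) = loc_pi (- x.1, x.2).
Proof.
rewrite /loc_opp; apply/loc_pi_eq.
have /loc_pi_eq[u Su hx] := loc_reprK (loc_pi x).
by exists u; rewrite //= !mulNr !mulrN hx.
Qed.

Lemma loc_mulE x y : loc_mul (loc_pi x) (loc_pi y) =
  loc_pi (x.1 * y.1, denM x.2 y.2).
Proof.
rewrite /loc_mul; apply/loc_pi_eq.
have /loc_pi_eq[u Su hx] := loc_reprK (loc_pi x).
have /loc_pi_eq[v Sv hy] := loc_reprK (loc_pi y).
set x' := loc_repr _ in hx *; set y' := loc_repr _ in hy *.
exists (u * v); first exact: monoid_spanM.
rewrite /= !den_valE.
transitivity ((u * (x'.1 * den_val x.2)) * (v * (y'.1 * den_val y.2))); first by ring.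
by rewrite hx hy; ring.
Qed.

Lemma loc_pi_eqW x y : x.1 * den_val y.2 = y.1 * den_val x.2 -> loc_pi x = loc_pi y.
Proof.
by move=> e; apply/loc_pi_eq; exists 1; rewrite ?mul1r //; apply: monoid_span1.
Qed.

Fact loc_addA : associative loc_add.
Proof.
move=> p q r; have [[[x ->] [y ->]] [z ->]] := (loc_piP p, loc_piP q, loc_piP r).
by rewrite !loc_addE; apply: loc_pi_eqW; rewrite /= ?den_valE /=; ring.
Qed.
Fact loc_addC : commutative loc_add.
Proof.
move=> p q; have [[x ->] [y ->]] := (loc_piP p, loc_piP q).
by rewrite !loc_addE; apply: loc_pi_eqW; rewrite /= ?den_valE /=; ring.
Qed.
Fact loc_add0 : left_id (loc_pi (0, den1)) loc_add.
Proof.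
move=> p; have [x ->] := loc_piP p.
by rewrite !loc_addE; apply: loc_pi_eqW; rewrite /= ?den_valE /=; ring.
Qed.
Fact loc_addN : left_inverse (loc_pi (0, den1)) loc_opp loc_add.
Proof.
move=> p; have [x ->] := loc_piP p.
by rewrite loc_oppE loc_addE; apply: loc_pi_eqW; rewrite /= ?den_valE /=; ring.
Qed.
HB.instance Definition _ := GRing.isZmodule.Build localization
  loc_addA loc_addC loc_add0 loc_addN.

Fact loc_mulA : associative loc_mul.
Proof.
move=> p q r; have [[[x ->] [y ->]] [z ->]] := (loc_piP p, loc_piP q, loc_piP r).
by rewrite !loc_mulE; apply: loc_pi_eqW; rewrite /= ?den_valE /=; ring.
Qed.
Fact loc_mulC : commutative loc_mul.
Proof.
move=> p q; have [[x ->] [y ->]] := (loc_piP p, loc_piP q).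
by rewrite !loc_mulE; apply: loc_pi_eqW; rewrite /= ?den_valE /=; ring.
Qed.
Fact loc_mul1 : left_id (loc_pi (1, den1)) loc_mul.
Proof.
move=> p; have [x ->] := loc_piP p.
by rewrite !loc_mulE; apply: loc_pi_eqW; rewrite /= ?den_valE /=; ring.
Qed.
Fact loc_mulDl : left_distributive loc_mul +%R.
Proof.
move=> p q r; have [[[x ->] [y ->]] [z ->]] := (loc_piP p, loc_piP q, loc_piP r).
rewrite -![_ + _]/(loc_add _ _) !(loc_addE, loc_mulE).
by apply: loc_pi_eqW; rewrite /= ?den_valE /=; ring.
Qed.
HB.instance Definition _ := GRing.Zmodule_isComPzRing.Build localization
  loc_mulA loc_mulC loc_mul1 loc_mulDl.

Lemma loc_piD x y : loc_pi x + loc_pi y =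
  loc_pi (x.1 * den_val y.2 + y.1 * den_val x.2, denM x.2 y.2).
Proof. exact: loc_addE. Qed.
Lemma loc_piN x : - loc_pi x = loc_pi (- x.1, x.2).
Proof. exact: loc_oppE. Qed.
Lemma loc_piM x y : loc_pi x * loc_pi y = loc_pi (x.1 * y.1, denM x.2 y.2).
Proof. exact: loc_mulE. Qed.

Definition loc_map (a : R) : localization := loc_pi (a, den1).

Lemma loc_map_zmod_morphism : zmod_morphism loc_map.
Proof.
by move=> a b; rewrite /loc_map loc_piN loc_piD; apply: loc_pi_eqW; rewrite /= ?den_valE /=; ring.
Qed.
Lemma loc_map_monoid_morphism : monoid_morphism loc_map.
Proof.
split=> // a b.
by rewrite /loc_map loc_piM; apply: loc_pi_eqW; rewrite /= ?den_valE /=; ring.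
Qed.
HB.instance Definition _ := GRing.isZmodMorphism.Build R localization loc_map
  loc_map_zmod_morphism.
HB.instance Definition _ := GRing.isMonoidMorphism.Build R localization loc_map
  loc_map_monoid_morphism.

Lemma loc_map_inv s : S s -> exists y, loc_map s * y = 1.
Proof.
move=> Ss; exists (loc_pi (1, den (monoid_span_gen Ss))).
by rewrite loc_piM; apply: loc_pi_eqW; rewrite /= ?den_valE /=; ring.
Qed.

Section Lift.
Variables (A : comPzRingType) (f : {rmorphism R -> A}).

Lemma monoid_span_inv (fS : forall s, S s -> exists y, f s * y = 1) s :
  monoid_span S s -> exists y, f s * y = 1.
Proof.
move=> [r [rS ->]]; elim: r rS => [|x r ih] rS.
  by exists 1; rewrite big_nil rmorph1 mulr1.
have [y hy] := fS x (rS x (mem_head x r)).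
have [z hz] : exists z, f (\prod_(x0 <- r) x0) * z = 1.
  by apply: ih => t tr; apply: rS; rewrite inE tr orbT.
by exists (y * z); rewrite big_cons rmorphM mulrACA hy hz mulr1.
Qed.

Definition den_inv (fS : forall s, S s -> exists y, f s * y = 1)
    (s : denominator) : A :=
  projT1 (cid (monoid_span_inv fS (asboolW (valP s)))).

Definition loc_lift (fS : forall s, S s -> exists y, f s * y = 1)
    (q : localization) : A :=
  f (loc_repr q).1 * den_inv fS (loc_repr q).2.

Hypothesis fS : forall s, S s -> exists y, f s * y = 1.

Lemma den_invP s : f (den_val s) * den_inv fS s = 1.
Proof. by rewrite /den_inv; case: cid. Qed.

Lemma loc_liftE x : loc_lift fS (loc_pi x) = f x.1 * den_inv fS x.2.
Proof.
have /loc_pi_eq[u Su hx] := loc_reprK (loc_pi x); rewrite /loc_lift.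
set x' := loc_repr _ in hx *.
have [w hw] := monoid_span_inv fS Su.
have hx' := den_invP x'.2; have hx2 := den_invP x.2.
set i' := den_inv _ _ in hx' *; set i := den_inv _ _ in hx2 *.
have h : f u * (f x'.1 * f (den_val x.2)) = f u * (f x.1 * f (den_val x'.2)).
  by rewrite -!rmorphM hx.
transitivity (w * i * i' * (f u * (f x'.1 * f (den_val x.2)))).
  transitivity (f x'.1 * i' * (f (den_val x.2) * i) * (f u * w)).
    by rewrite hw hx2 !mulr1.
  by ring.
rewrite h.
transitivity (f x.1 * i * (f (den_val x'.2) * i') * (f u * w)); first by ring.
by rewrite hw hx' !mulr1.
Qed.

Lemma loc_lift_map a : loc_lift fS (loc_map a) = f a.
Proof.
rewrite loc_liftE /=; have := den_invP den1.
by rewrite den_val1 rmorph1 mul1r => ->; rewrite mulr1.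
Qed.

Lemma den_invM s t : den_inv fS (denM s t) = den_inv fS s * den_inv fS t.
Proof.
have hs := den_invP s; have ht := den_invP t; have := den_invP (denM s t).
rewrite den_valM rmorphM => hst.
rewrite -[LHS]mulr1 -[X in _ * X = _](mulr1 1) -{1}hs -ht.
transitivity (den_inv fS s * den_inv fS t *
  (f (den_val s) * f (den_val t) * den_inv fS (denM s t))); first by ring.
by rewrite hst mulr1.
Qed.

Lemma loc_lift_zmod_morphism : zmod_morphism (loc_lift fS).
Proof.
move=> p q; have [[x ->] [y ->]] := (loc_piP p, loc_piP q).
rewrite loc_piN loc_piD !loc_liftE /= den_invM !(rmorphD, rmorphM, rmorphN).
have hs := den_invP x.2; have ht := den_invP y.2.
transitivity (f x.1 * den_inv fS x.2 * (f (den_val y.2) * den_inv fS y.2)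
  - f y.1 * den_inv fS y.2 * (f (den_val x.2) * den_inv fS x.2)); first by ring.
by rewrite hs ht !mulr1.
Qed.
Lemma loc_lift_monoid_morphism : monoid_morphism (loc_lift fS).
Proof.
split; first by rewrite -(rmorph1 loc_map) loc_lift_map rmorph1.
move=> p q; have [[x ->] [y ->]] := (loc_piP p, loc_piP q).
by rewrite loc_piM !loc_liftE /= den_invM rmorphM; ring.
Qed.
HB.instance Definition _ := GRing.isZmodMorphism.Build localization A
  (loc_lift fS) loc_lift_zmod_morphism.
HB.instance Definition _ := GRing.isMonoidMorphism.Build localization A
  (loc_lift fS) loc_lift_monoid_morphism.
End Lift.

End Localization.

(* The completion is the ring of I-adic Cauchy sequences modulo null sequences. *)
Section Completion.
Variables (R : comPzRingType) (I : R -> Prop).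

Definition is_cauchy (x : nat -> R) : Prop :=
  forall k, exists N, forall i j,
    (N <= i)%N -> (N <= j)%N -> ideal_pow I k (x i - x j).

Definition is_null (x : nat -> R) : Prop :=
  forall k, exists N, forall i, (N <= i)%N -> ideal_pow I k (x i).

Definition cauchyb : {pred (nat -> R)} := fun x => `[< is_cauchy x >].

Fact cauchyb_subring_closed : subring_closed cauchyb.
Proof.
have powI k : is_ideal (ideal_pow I k) by apply: ideal_span_is_ideal.
split=> [|x y /asboolP cx /asboolP cy|x y /asboolP cx /asboolP cy];
  apply/asboolP => k; have [i0 iD iM] := powI k.
- by exists 0%N => i j _ _; rewrite /= subrr.
- have [M hM] := cx k; have [N hN] := cy k.
  exists (maxn M N) => i j; rewrite !geq_max => /andP[Mi Ni] /andP[Mj Nj].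
  have -> : (x - y) i - (x - y) j = x i - x j + (-1) * (y i - y j).
    by rewrite -![(x - y) _]/(x _ - y _); ring.
  by apply: iD; [apply: hM|apply/iM/hN].
- have [M hM] := cx k; have [N hN] := cy k.
  exists (maxn M N) => i j; rewrite !geq_max => /andP[Mi Ni] /andP[Mj Nj].
  have -> : (x * y) i - (x * y) j = y i * (x i - x j) + x j * (y i - y j).
    by rewrite -![(x * y) _]/(x _ * y _); ring.
  by apply: iD; apply: iM; [apply: hM|apply: hN].
Qed.

Definition cauchy_seq : Type := {x : nat -> R | x \in cauchyb}.
HB.instance Definition _ := SubChoice.on cauchy_seq.
HB.instance Definition _ := GRing.SubChoice_isSubComPzRing.Build
  (nat -> R) _ cauchy_seq cauchyb_subring_closed.

Definition completion : Type := quotient (fun x : cauchy_seq => is_null (\val x)).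
HB.instance Definition _ := GRing.ComPzRing.on completion.

Fact cst_cauchy (a : R) : (fun _ : nat => a) \in cauchyb.
Proof.
apply/asboolP => k; exists 0%N => i j _ _; rewrite subrr.
by have [] := ideal_span_is_ideal (fun a => exists s : seq R,
  [/\ size s = k, forall x, x \in s -> I x & a = \prod_(x <- s) x]).
Qed.

Definition cst_seq (a : R) : cauchy_seq :=
  exist (fun x => is_true (x \in cauchyb)) _ (cst_cauchy a).
Fact cst_seq_zmod_morphism : zmod_morphism cst_seq.
Proof. by move=> a b; apply: val_inj. Qed.
Fact cst_seq_monoid_morphism : monoid_morphism cst_seq.
Proof. by split=> [|a b]; apply: val_inj. Qed.
HB.instance Definition _ := GRing.isZmodMorphism.Build R cauchy_seq cst_seq
  cst_seq_zmod_morphism.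
HB.instance Definition _ := GRing.isMonoidMorphism.Build R cauchy_seq cst_seq
  cst_seq_monoid_morphism.

Definition completion_map : {rmorphism R -> completion} :=
  [the {rmorphism _ -> _} of @quot_pi _ (fun x => is_null (\val x)) \o cst_seq].

End Completion.

Section PowerSeries.
Variables (n : nat) (R : comNzRingType).

Definition pseries : Type := 'X_{1.. n} -> R.
HB.instance Definition _ := GRing.Zmodule.copy pseries ('X_{1.. n} -> R).
Implicit Types (f g h : pseries) (m : 'X_{1.. n}).

Definition pseries_mul f g : pseries := fun m =>
  \sum_(p : 'X_{1.. n < (mdeg m).+1, (mdeg m).+1} | m == (p.1 + p.2)%MM)
    f p.1 * g p.2.

Definition pseries_of (p : {mpoly R[n]}) : pseries := fun m => p@_m.

Definition truncation (k : nat) f : {mpoly R[n]} :=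
  \sum_(m : 'X_{1.. n < k}) f m *: 'X_[m].

Lemma mcoeff_truncation k f m : (mdeg m < k)%N -> (truncation k f)@_m = f m.
Proof.
move=> mk; rewrite raddf_sum /= (bigD1 (BMultinom mk)) //=.
rewrite mcoeffZ mcoeffX eqxx mulr1 big1 ?addr0 // => i ne.
rewrite mcoeffZ mcoeffX; case: eqP => [e|]; last by rewrite mulr0.
by case/eqP: ne; apply: val_inj.
Qed.

Lemma pseries_of_mul p q m :
  pseries_mul (pseries_of p) (pseries_of q) m = (p * q)@_m.
Proof. by rewrite mcoeffM. Qed.

Lemma eq_pseries_mul f g f' g' m :
  (forall m', (mdeg m' <= mdeg m)%N -> f m' = f' m') ->
  (forall m', (mdeg m' <= mdeg m)%N -> g m' = g' m') ->
  pseries_mul f g m = pseries_mul f' g' m.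
Proof.
move=> ef eg; apply: eq_bigr => p _.
by rewrite ef ?eg // -ltnS bmdeg.
Qed.

Lemma pseries_mul_truncation k f g m : (mdeg m < k)%N ->
  pseries_mul f g m = (truncation k f * truncation k g)@_m.
Proof.
move=> mk; rewrite -pseries_of_mul.
by apply: eq_pseries_mul => m' m'm; rewrite /pseries_of mcoeff_truncation //;
  apply: leq_ltn_trans mk.
Qed.

Fact pseries_mulA : associative pseries_mul.
Proof.
move=> f g h; apply/funext => m.
pose T := truncation (mdeg m).+1.
have TE f' m' : (mdeg m' <= mdeg m)%N -> f' m' = (T f')@_m'.
  by move=> ?; rewrite mcoeff_truncation.
transitivity (T f * (T g * T h))@_m.
  rewrite -pseries_of_mul; apply: eq_pseries_mul => m' m'm; first exact: TE.
  exact: pseries_mul_truncation.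
rewrite mulrA -pseries_of_mul; symmetry; apply: eq_pseries_mul => m' m'm; last first.
  exact: TE.
exact: pseries_mul_truncation.
Qed.

Fact pseries_mulC : commutative pseries_mul.
Proof.
move=> f g; apply/funext => m.
by rewrite !(pseries_mul_truncation (k := (mdeg m).+1)) // mulrC.
Qed.

Fact pseries_mul1 : left_id (pseries_of 1) pseries_mul.
Proof.
move=> f; apply/funext => m; set k := (mdeg m).+1.
rewrite -[RHS](@mcoeff_truncation k) // -[truncation k f]mul1r -pseries_of_mul.
by apply: eq_pseries_mul => // m' m'm; rewrite /pseries_of mcoeff_truncation.
Qed.

Fact pseries_mulDl : left_distributive pseries_mul +%R.
Proof.
move=> f g h; apply/funext => m.
rewrite -[RHS]/(pseries_mul f h m + pseries_mul g h m) -big_split /=.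
by apply: eq_bigr => p _; rewrite -mulrDl.
Qed.

HB.instance Definition _ := GRing.Zmodule_isComPzRing.Build pseries
  pseries_mulA pseries_mulC pseries_mul1 pseries_mulDl.

Fact pseries_of_zmod_morphism : zmod_morphism pseries_of.
Proof. by move=> p q; apply/funext => m; rewrite /pseries_of mcoeffB. Qed.
Fact pseries_of_monoid_morphism : monoid_morphism pseries_of.
Proof. by split=> // p q; apply/funext => m; rewrite -[LHS]pseries_of_mul. Qed.
HB.instance Definition _ := GRing.isZmodMorphism.Build {mpoly R[n]} pseries
  pseries_of pseries_of_zmod_morphism.
HB.instance Definition _ := GRing.isMonoidMorphism.Build {mpoly R[n]} pseries
  pseries_of pseries_of_monoid_morphism.

End PowerSeries.

(* Completed local ring of [Spec A] at the closed point given by a maximal     *)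
(* ideal [p]; the ideal generated by the image of [p] is the maximal ideal of  *)
(* the local ring.                                                             *)
Section CompletedLocalRing.
Variables (A : comPzRingType) (p : A -> Prop).

Definition local_ring : comPzRingType := localization (fun a => ~ p a).

Definition local_max : local_ring -> Prop :=
  ideal_span (fun x => exists2 a, p a & x = loc_map _ a).

Definition completed_local_ring : comPzRingType := completion local_max.

Definition completed_local_map : {rmorphism A -> completed_local_ring} :=
  [the {rmorphism _ -> _} of completion_map local_max \o @loc_map A _].

End CompletedLocalRing.

Section Nodes.
Variable k : fieldType.

(* k[[u, v, z_1, ..., z_m]] / (uv) *)
Definition node_ring (m : nat) : comPzRingType :=
  quotient (fun x : pseries m.+2 k =>
    x = pseries_of ('X_(inord 0) * 'X_(inord 1))).

Definition node_const (m : nat) (c : k) : node_ring m :=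
  quot_pi _ (pseries_of c%:MP_[m.+2]).

(* The isomorphism is one of [k]-algebras. *)
Definition node_at (A : comPzRingType) (eta : {rmorphism k -> A})
    (p : A -> Prop) : Prop :=
  exists m (phi : {rmorphism completed_local_ring p -> node_ring m}),
    bijective phi /\ forall c, phi (completed_local_map p (eta c)) = node_const m c.

Definition has_nodal_singularities (A : comPzRingType)
    (eta : {rmorphism k -> A}) : Prop :=
  exists2 p : A -> Prop, maximal_ideal p & node_at eta p.

End Nodes.

Definition matroid_bases (T : finType) (E : {set T}) (B : {set {set T}}) : Prop :=
  [/\ B != set0,
      forall b, b \in B -> b \subset E &
      forall b1 b2 x, b1 \in B -> b2 \in B -> x \in b1 :\: b2 ->
        exists2 y, y \in b2 :\: b1 & y |: (b1 :\ x) \in B].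

Record matroid (d n : nat) := Matroid {
  bases :> {set {set 'I_n}};
  bases_matroid : matroid_bases [set: 'I_n] bases;
  bases_rank : forall b, b \in bases -> #|b| = d
}.

Definition connected_matroid d n (Q : matroid d n) : Prop :=
  ~ exists E : {set 'I_n}, exists B1 B2 : {set {set 'I_n}},
    [/\ E != set0, E != [set: 'I_n], matroid_bases E B1, matroid_bases (~: E) B2
      & bases Q = [set b1 :|: b2 | b1 in B1, b2 in B2]].

Lemma matroid_rank_le d n (Q : matroid d n) : (d <= n)%N.
Proof.
have [/set0Pn[b bQ] _ _] := bases_matroid Q.
by rewrite -(bases_rank bQ) -[X in (_ <= X)%N]card_ord max_card.
Qed.

Fact relabel_matroid d n (s : 'S_n) (Q : matroid d n) :
  matroid_bases [set: 'I_n] [set s @: b | b : {set 'I_n} in bases Q].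
Proof.
have [/set0Pn[b0 b0Q] _ exch] := bases_matroid Q.
split.
- by apply/set0Pn; exists (s @: b0); apply: imset_f.
- by move=> b _; apply: subsetT.
move=> _ _ x /imsetP[b1 b1Q ->] /imsetP[b2 b2Q ->].
rewrite inE => /andP[xb2 /imsetP[y yb1 ex]]; rewrite {x}ex in xb2 *.
rewrite mem_imset in xb2; last exact: perm_inj.
have [|z] := exch b1 b2 y b1Q b2Q; first by rewrite inE xb2.
rewrite inE => /andP[zb1 zb2] zQ; exists (s z).
  by rewrite inE !mem_imset ?zb1 //; apply: perm_inj.
apply/imsetP; exists (z |: (b1 :\ y)) => //.
rewrite imsetU1; congr (_ |: _).
apply/setP => u; rewrite !inE.
have -> : u = s ((s^-1)%g u) by rewrite permKV.
by rewrite !mem_imset ?inE ?(inj_eq perm_inj) //; apply: perm_inj.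
Qed.

Fact relabel_rank d n (s : 'S_n) (Q : matroid d n) (b : {set 'I_n}) :
  b \in [set s @: b | b : {set 'I_n} in bases Q] -> #|b| = d.
Proof.
case/imsetP => b' /bases_rank <- ->.
by rewrite card_imset //; apply: perm_inj.
Qed.

Definition relabel d n (s : 'S_n) (Q : matroid d n) : matroid d n :=
  Matroid (relabel_matroid s Q) (@relabel_rank d n s Q).

(* For [#|l| = d], the maximal minor of [A] on the columns in [l], in          *)
(* increasing order.                                                           *)
Definition plucker (R : comNzRingType) (d n : nat) (A : 'M[R]_(d, n))
    (l : {set 'I_n}) : R :=
  \det (\matrix_(i < d, j < d) [seq A i k | k <- enum l]`_j).

(* The subspace is the row space of [V]. *)
Definition realizable (F : fieldType) d n (Q : matroid d n) : Prop :=
  exists2 V : 'M[F]_(d, n), \rank V = d &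
    forall l : {set 'I_n}, #|l| = d -> (plucker V l != 0) = (l \in bases Q).

Definition initial_set (d n : nat) : {set 'I_n} := [set k : 'I_n | (k < d)%N].

(* The ring S_Q and its torus invariants. The definitions are meaningful when  *)
(* [initial_set d n] is a basis of [Q]. The variable x_ij of the               *)
(* generic matrix [I_d | (x_ij)] is indexed by the row [i] and by the column   *)
(* [k] of the full matrix that contains it, with [k = d + j] counting from 0.  *)
Section Realization.
Variables (F : fieldType) (d n : nat) (Q : matroid d n).

Definition exchange (i : 'I_d) (k : 'I_n) : {set 'I_n} :=
  k |: [set j in initial_set d n | j != i :> nat].

Definition chart_var : Type :=
  {ik : 'I_d * 'I_n | (d <= ik.2)%N && (exchange ik.1 ik.2 \in bases Q)}.
HB.instance Definition _ := Finite.on chart_var.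

Definition chart_ring : comNzRingType := {mpoly F[#|{: chart_var}|]}.

Definition chart_matrix : 'M[chart_ring]_(d, n) :=
  \matrix_(i, k)
    if (k < d)%N then (k == i :> nat)%:R
    else if insub (i, k) is Some v then 'X_(enum_rank (v : chart_var)) else 0.

Definition nonbasis_minor (f : chart_ring) : Prop :=
  exists l : {set 'I_n}, [/\ #|l| = d, l \notin bases Q & f = plucker chart_matrix l].

Definition chart_quotient : comPzRingType := quotient nonbasis_minor.

Definition basis_minor (q : chart_quotient) : Prop :=
  exists2 l : {set 'I_n}, l \in bases Q & q = quot_pi _ (plucker chart_matrix l).

Definition stratum_ring : comPzRingType := localization basis_minor.

Definition stratum_const : {rmorphism F -> stratum_ring} :=
  [the {rmorphism _ -> _} of
    @loc_map _ basis_minor \o (@quot_pi _ nonbasis_minor \o @mpolyC _ F)].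

(* The points of (F^* )^n; the diagonal acts trivially. For F infinite, the    *)
(* invariants of this group are those of the algebraic torus.                  *)
Definition torus : Type := {t : {ffun 'I_n -> F} | [forall k, t k != 0]}.

Definition row_index (i : 'I_d) : 'I_n := widen_ord (matroid_rank_le Q) i.

(* Scaling column [k] by [t k] turns [I_d | (x_ij)] into a matrix whose row    *)
(* space is that of [I_d | (t (d + j) / t i * x_ij)].                          *)
Definition chart_scale (t : torus) : #|{: chart_var}|.-tuple chart_ring :=
  [tuple (\val t (\val (enum_val v)).2 / \val t (row_index (\val (enum_val v)).1))
         *: 'X_v | v < #|{: chart_var}|].

Definition chart_act (t : torus) : {rmorphism chart_ring -> chart_ring} :=
  [the {rmorphism _ -> _} of comp_mpoly (chart_scale t)].

Definition minor_weight (t : torus) (l : {set 'I_n}) : F :=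
  (\prod_(k in l) \val t k) / \prod_(i < d) \val t (row_index i).

Lemma torus_neq0 (t : torus) k : \val t k != 0.
Proof. by have /forallP := valP t. Qed.

Lemma minor_weight_neq0 t l : minor_weight t l != 0.
Proof.
rewrite mulf_neq0 ?invr_eq0 //; apply/prodf_neq0 => *; exact: torus_neq0.
Qed.

Lemma chart_act_matrix t i k :
  chart_act t (chart_matrix i k)
  = (\val t k / \val t (row_index i)) *: chart_matrix i k.
Proof.
rewrite mxE; case: ifP => kd.
  rewrite rmorph_nat; case: eqP => [e|_]; last by rewrite scaler0.
  have -> : row_index i = k by apply: val_inj.
  by rewrite divff ?torus_neq0 // scale1r.
case: insubP => [v _ ev|_]; last by rewrite rmorph0 scaler0.
by rewrite /= comp_mpolyXU -tnth_nth tnth_mktuple enum_rankK ev.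
Qed.

Lemma chart_act_plucker t (l : {set 'I_n}) : #|l| = d ->
  chart_act t (plucker chart_matrix l)
  = (minor_weight t l)%:MP * plucker chart_matrix l.
Proof.
move=> ld; rewrite /plucker -det_map_mx.
pose c (j : 'I_d) : 'I_n := enum_val (cast_ord (esym ld) j).
have nthE (f : 'I_n -> chart_ring) (j : 'I_d) : [seq f k | k <- enum l]`_j = f (c j).
  rewrite (nth_map (c j)); last by rewrite -cardE ld.
  congr (f _); symmetry; exact: enum_val_nth.
set M := (X in _ * \det X).
have -> : map_mx (chart_act t) M =
    diag_mx (\row_i ((\val t (row_index i))^-1)%:MP) *m M
    *m diag_mx (\row_j (\val t (c j))%:MP).
  apply/matrixP => i j; rewrite mul_mx_diag mul_diag_mx !mxE !nthE.
  rewrite chart_act_matrix -mul_mpolyC mpolyCM; ring.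
rewrite !det_mulmx !det_diag /minor_weight mulrAC; congr (_ * _).
rewrite -prodfV mpolyCM mulrC !rmorph_prod; congr (_ * _).
  rewrite [RHS]big_enum_val [RHS](reindex (cast_ord (esym ld))) /=.
    by apply: eq_bigr => j _; rewrite mxE.
  by apply: onW_bij; exists (cast_ord ld) => j; rewrite ?cast_ordK ?cast_ordKV.
by apply: eq_bigr => i _; rewrite mxE.
Qed.

End Realization.

Section Invariants.
Variables (F : fieldType) (d n : nat) (Q : matroid d n).
Notation chart_quotient := (chart_quotient F Q).
Notation stratum_ring := (stratum_ring F Q).

Fact quotient_act_subproof (t : torus F n) (f : chart_ring F Q) :
  nonbasis_minor f -> (@quot_pi _ (@nonbasis_minor F d n Q) \o chart_act Q t) f = 0.
Proof.
move=> fN; have [l [ld lQ ->]] := fN.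
rewrite /= chart_act_plucker // rmorphM [X in _ * X](_ : _ = 0) ?mulr0 //.
rewrite -(rmorph0 (@quot_pi _ (@nonbasis_minor F d n Q))).
apply/quot_pi_eq; rewrite subr0; apply: ideal_span_gen; by exists l.
Qed.

Definition quotient_act (t : torus F n) : {rmorphism chart_quotient -> chart_quotient} :=
  [the {rmorphism _ -> _} of quot_lift (quotient_act_subproof t)].

Lemma quotient_actE t (f : chart_ring F Q) :
  quotient_act t (quot_pi _ f) = quot_pi _ (chart_act Q t f).
Proof. exact: quot_liftE. Qed.

Fact stratum_act_subproof (t : torus F n) (q : chart_quotient) : basis_minor q ->
  exists y, (@loc_map _ (@basis_minor F d n Q) \o quotient_act t) q * y = 1.
Proof.
move=> qB; have [l lQ eq] := qB; have [y qy] := loc_map_inv qB.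
exists (y * stratum_const F Q (minor_weight Q t l)^-1).
have -> : (@loc_map _ (@basis_minor F d n Q) \o quotient_act t) q
    = stratum_const F Q (minor_weight Q t l) * loc_map _ q.
  transitivity (loc_map (@basis_minor F d n Q) (quotient_act t q)); first by [].
  rewrite eq quotient_actE chart_act_plucker ?(bases_rank lQ) //.
  by rewrite !rmorphM.
rewrite mulrA -[_ * _ * y]mulrA qy mulr1.
by rewrite -rmorphM divff ?rmorph1 // minor_weight_neq0.
Qed.

Definition stratum_act (t : torus F n) : {rmorphism stratum_ring -> stratum_ring} :=
  [the {rmorphism _ -> _} of loc_lift (stratum_act_subproof t)].

Lemma stratum_actE t (q : chart_quotient) :
  stratum_act t (loc_map _ q) = loc_map _ (quotient_act t q).
Proof. exact: loc_lift_map. Qed.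

Definition torus_invariant : {pred stratum_ring} :=
  fun s => `[< forall t : torus F n, stratum_act t s = s >].

Fact torus_invariant_subring_closed : subring_closed torus_invariant.
Proof.
split=> [|x y /asboolP xT /asboolP yT|x y /asboolP xT /asboolP yT];
  apply/asboolP => t; first exact: rmorph1.
- by rewrite rmorphB xT yT.
- by rewrite rmorphM xT yT.
Qed.

Definition realization_ring : Type := {s : stratum_ring | s \in torus_invariant}.
HB.instance Definition _ := SubChoice.on realization_ring.
HB.instance Definition _ := GRing.SubChoice_isSubComPzRing.Build
  stratum_ring _ realization_ring torus_invariant_subring_closed.

Fact stratum_const_invariant (c : F) : stratum_const F Q c \in torus_invariant.
Proof.
by apply/asboolP => t; rewrite [LHS]stratum_actE quotient_actE [chart_act _ _ _]comp_mpolyC.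
Qed.

Definition realization_const (c : F) : realization_ring :=
  exist (fun s => is_true (s \in torus_invariant)) _ (stratum_const_invariant c).

Fact realization_const_zmod_morphism : zmod_morphism realization_const.
Proof. by move=> a b; apply: val_inj; rewrite /= !rmorphB. Qed.
Fact realization_const_monoid_morphism : monoid_morphism realization_const.
Proof.
by split=> [|a b]; apply: val_inj; rewrite /= ?rmorph1 ?rmorphM.
Qed.
HB.instance Definition _ := GRing.isZmodMorphism.Build F realization_ring
  realization_const realization_const_zmod_morphism.
HB.instance Definition _ := GRing.isMonoidMorphism.Build F realization_ring
  realization_const realization_const_monoid_morphism.

End Invariants.

(* The realization space is computed after a relabelling [s] that makes the    *)
(* initial set a basis; different choices of [s] give isomorphic algebras.     *)
Definition realization_space_nodal (F : fieldType) d n (Q : matroid d n) : Prop :=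
  exists2 s : 'S_n, initial_set d n \in bases (relabel s Q) &
    has_nodal_singularities
      [the {rmorphism F -> _} of @realization_const F d n (relabel s Q)].

(* Main.v *)
(** The matroid has twelve points, found by computer search: a projective frame
    followed by eight points whose normalized coordinates are polynomials in
    three parameters m, r, h. Two of the collinearities remain; one
    determines h, and eliminating h from the other gives
      r (m - 2) ((1 - m) - r (m^2 - m + 1)) = 0
    with r invertible. So the realization space is cut out by u v = 0 for
    u = m - 2 and v = (1 - m) - r (m^2 - m + 1). The remaining coordinates
    are determined at u = v = 0, hence the coordinate ring is C + (u, v), and
    explicit families of realizations over the two branches give a map to
    C[[u, v]]/(uv) sending u to u and v to v; such a map induces an
    isomorphism from the completion at (u, v). For n > 12 the last point is repeated,
    which does not change the realization space.

    The torus invariants are reached through the normalization of a realization by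
    its frame: an element of S_Q invariant under the points of the torus over the
    infinite field C is fixed by every substitution x_ik -> (e_k / e_i) x_ik
    with units e of S_Q, in particular by the one that normalizes the frame. *)

Require Import Defs.
From HB Require Import structures.
From mathcomp Require Import all_boot all_order all_fingroup all_algebra.
From mathcomp Require Import ring boolp functions reals complex mpoly.

Set Implicit Arguments.
Unset Strict Implicit.
Unset Printing Implicit Defensive.

Import Order.TTheory GRing.Theory Num.Theory.

Local Open Scope ring_scope.

(** * Power series modulo uv *)

Lemma ideal_span1 (R : comPzRingType) (x a : R) :
  ideal_span (fun y => y = x) a <-> exists g, a = g * x.
Proof.
split=> [[s [sx ->]]|[g ->]]; last first.
  have [_ _ iM] := ideal_span_is_ideal (fun y => y = x).
  by apply: iM; apply: ideal_span_gen.
exists (\sum_(p <- s) p.1); rewrite mulr_suml big_seq [RHS]big_seq.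
by apply: eq_bigr => p /sx ->.
Qed.

(** * The order filtration on power series and on the node ring *)

Section OrderFiltration.
Variables (n : nat) (R : comNzRingType).
Implicit Types f g : pseries n R.

Definition pseries_ord (d : nat) f := forall m, (mdeg m < d)%N -> f m = 0.

Lemma pseries_ord_mul i j f g :
  pseries_ord i f -> pseries_ord j g -> pseries_ord (i + j) (f * g).
Proof.
move=> fi gj m mij; rewrite -[_ m]/(pseries_mul f g m) /pseries_mul.
rewrite big1 // => -[a b] /= /eqP e.
have [ai|ia] := ltnP (mdeg a) i; first by rewrite fi ?mul0r.
rewrite [g b]gj ?mulr0 //; rewrite e mdegD in mij.
by rewrite -(ltn_add2l i); apply: leq_ltn_trans mij; rewrite leq_add2r.
Qed.

Lemma pseries_ordD d f g :
  pseries_ord d f -> pseries_ord d g -> pseries_ord d (f + g).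
Proof. by move=> fd gd m md; rewrite -[LHS]/(f m + g m) fd ?gd ?addr0. Qed.

Lemma pseries_ordN d f : pseries_ord d f -> pseries_ord d (- f).
Proof. by move=> fd m md; rewrite -[LHS]/(- f m) fd ?oppr0. Qed.

(** Each coefficient of a product depends on finitely many coefficients of the factors, so
    truncation reduces the claim to polynomials. *)
Lemma pseries_mulXE (a m : 'X_{1..n}) g :
  (g * pseries_of 'X_[a] : pseries n R) m = if (a <= m)%MM then g (m - a)%MM else 0.
Proof.
rewrite -[LHS]/(pseries_mul g (pseries_of 'X_[a]) m).
set T := truncation (mdeg m).+1 g.
have -> : pseries_mul g (pseries_of 'X_[a]) m = (T * 'X_[a])@_m.
  rewrite -pseries_of_mul; apply: eq_pseries_mul => // m' m'm.
  by rewrite /pseries_of mcoeff_truncation.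
case: ifP => am.
  have -> : (T * 'X_[a])@_m = (T * 'X_[a])@_(a + (m - a)) by rewrite addmC submK.
  by rewrite mcoeffMX mcoeff_truncation // ltnS mdegB.
apply/eqP; rewrite mcoeff_eq0; apply/negP => mT.
have := msuppM_le mT => /allpairsP[[x y] /=] [_].
rewrite msuppX inE => /eqP -> e; move: am; rewrite e.
by move=> /negP; apply; exact: lem_addl.
Qed.

End OrderFiltration.

Section NodeFiltration.
Variable k : fieldType.
Local Notation P := (pseries 2 k).
Local Notation N := (node_ring k 0).
Local Notation i0 := (inord 0 : 'I_2).
Local Notation i1 := (inord 1 : 'I_2).
Local Notation npi := (@quot_pi P (fun x => x = pseries_of ('X_i0 * 'X_i1))).
Implicit Types (f g : P) (x y z : N) (c : k) (m : 'X_{1..2}).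

Definition node_u : N := npi (pseries_of 'X_i0).
Definition node_v : N := npi (pseries_of 'X_i1).

Definition node_of : {rmorphism {mpoly k[2]} -> N} :=
  [the {rmorphism _ -> _} of npi \o @pseries_of 2 k].

(** This is the [d]-th power of the maximal ideal [(u, v)] of [k[[u, v]]/(uv)], described by
    representatives of order at least [d]. *)
Definition node_ord d x := exists2 f, pseries_ord d f & x = npi f.

(** Exponents of the monomials not divisible by [uv], that is, of pure powers of [u] or of [v];
    these survive in the quotient. *)
Definition on_axis m := (m i0 == 0%N) || (m i1 == 0%N).

Lemma i0_neq_i1 : (i0 == i1) = false.
Proof. by rewrite -val_eqE /= !inordK. Qed.

Lemma ord2E (i : 'I_2) : i = i0 \/ i = i1.
Proof.
by case: i => [[|[|?]] ?] //; [left|right]; apply: val_inj; rewrite /= inordK.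
Qed.

Lemma mdeg2E m : mdeg m = (m i0 + m i1)%N.
Proof.
rewrite mdegE 2!big_ord_recl big_ord0 addn0.
by congr (m _ + m _)%N; apply: val_inj; rewrite /= inordK.
Qed.

Lemma mnm2P m m' : m i0 = m' i0 -> m i1 = m' i1 -> m = m'.
Proof. by move=> e0 e1; apply/mnmP => i; case: (ord2E i) => ->. Qed.

Lemma on_axisE m : on_axis m = ~~ (U_(i0) + U_(i1) <= m)%MM.
Proof.
rewrite /on_axis; apply/idP/negP => [h /mnm_lepP le|h].
  have := le i0; have := le i1; rewrite !mnmDE !mnm1E !eqxx [i1 == i0]eq_sym i0_neq_i1.
  by case/orP: h => /eqP ->.
apply/negbNE/negP; rewrite negb_or -!lt0n => /andP[m0 m1]; apply: h.
apply/mnm_lepP => i; rewrite mnmDE !mnm1E.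
by case: (ord2E i) => ->; rewrite eqxx ?[i1 == i0]eq_sym i0_neq_i1.
Qed.

(** A series without axis monomials is divisible by [uv]: the cofactor is obtained by shifting all
    exponents by [(1, 1)]. *)
Lemma node_eq0 f : (npi f : N) = 0 <-> forall m, on_axis m -> f m = 0.
Proof.
rewrite -(rmorph0 npi) quot_pi_eq subr0 ideal_span1 -mpolyXD.
split=> [[g ->] m|h]; first by rewrite pseries_mulXE on_axisE => /negPf ->.
exists (fun m => f (U_(i0) + U_(i1) + m)%MM); apply/funext => m.
rewrite pseries_mulXE; case: ifPn => [le|]; last by rewrite -on_axisE => /h.
by rewrite addmC submK.
Qed.

Lemma node_uv : node_u * node_v = 0.
Proof.
rewrite -(rmorphM npi) -(rmorphM (@pseries_of 2 k)) -(rmorph0 npi); apply/quot_pi_eq.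
by rewrite subr0; apply: ideal_span_gen.
Qed.

Lemma node_ordD d x y : node_ord d x -> node_ord d y -> node_ord d (x + y).
Proof.
move=> [f fd ->] [g gd ->]; exists (f + g); last by rewrite (rmorphD npi).
exact: pseries_ordD.
Qed.

Lemma node_ordN d x : node_ord d x -> node_ord d (- x).
Proof.
move=> [f fd ->]; exists (- f); last by rewrite (rmorphN npi).
exact: pseries_ordN.
Qed.

Lemma node_ordB d x y : node_ord d x -> node_ord d y -> node_ord d (x - y).
Proof. by move=> xd yd; apply: node_ordD => //; apply: node_ordN. Qed.

Lemma node_ordM i j x y : node_ord i x -> node_ord j y -> node_ord (i + j) (x * y).
Proof.
move=> [f fd ->] [g gd ->]; exists (f * g); last by rewrite (rmorphM npi).
exact: pseries_ord_mul.
Qed.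

Lemma node_ordW i j x : (i <= j)%N -> node_ord j x -> node_ord i x.
Proof. by move=> ij [f fj ->]; exists f => // m mi; apply: fj; apply: leq_trans ij. Qed.

Lemma node_ord_any x : node_ord 0 x.
Proof. by have [f ->] := quot_piP x; exists f. Qed.

Lemma node_ordMl d x y : node_ord d x -> node_ord d (y * x).
Proof. by rewrite -{2}[d]add0n; apply: node_ordM (node_ord_any y). Qed.

Lemma node_ord0 d : node_ord d 0.
Proof. by exists 0; rewrite ?(rmorph0 npi). Qed.

(** A change of representative alters only coefficients off the axes, so the axis coefficients
    detect the order on any representative. *)
Lemma node_ord_axis d f m :
  node_ord d (npi f) -> on_axis m -> (mdeg m < d)%N -> f m = 0.
Proof.
move=> [g gd /eqP]; rewrite -subr_eq0 -(rmorphB npi) => /eqP /node_eq0 h mx md.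
by have := h m mx; rewrite -[LHS]/(f m - g m) gd // subr0.
Qed.

Lemma node_separated x : (forall d, node_ord d x) -> x = 0.
Proof.
have [f ->] := quot_piP x => h; apply/node_eq0 => m mx.
exact: node_ord_axis (h (mdeg m).+1) mx (ltnSn _).
Qed.

Lemma node_complete (y : nat -> N) :
  (forall d, node_ord d (y d.+1 - y d)) -> exists z, forall d, node_ord d (z - y d).
Proof.
move=> h; have [f0 ef0] := quot_piP (y 0%N).
have /choice[g hg] d : exists g, pseries_ord d g /\ y d.+1 - y d = npi g.
  by have [g] := h d; exists g.
pose F d : P := f0 + \sum_(j < d) g j.
have yF d : y d = npi (F d).
  rewrite (rmorphD npi) (rmorph_sum npi) /= -ef0.
  elim: d => [|d IH]; first by rewrite big_ord0 addr0.
  by rewrite big_ord_recr /= addrA -IH -(hg d).2 addrC subrK.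
(* The term [g j] has order [j], so the coefficient at [m] no longer changes from the partial sum
   number [mdeg m + 1] on. *)
exists (npi (fun m => F (mdeg m).+1 m)) => d.
exists (fun m => F (mdeg m).+1 m - F d m); last by rewrite yF -(rmorphB npi).
have FS i : F i.+1 = F i + g i by rewrite /F big_ord_recr addrA.
have FE i m : (mdeg m < i)%N -> F (mdeg m).+1 m = F i m.
  move=> /subnKC <-; elim: (i - _)%N => [|j ->]; first by rewrite addn0.
  rewrite addnS FS -[RHS]/(F _ m + g _ m).
  by rewrite (hg _).1 ?addr0 // ltnS leq_addr.
by move=> m md; rewrite -[LHS]/(F _ m - F d m) (FE _ _ md) subrr.
Qed.

Lemma node_leadingE j (a b : k) :
  node_const 0 a * node_u ^+ j + node_const 0 b * node_v ^+ j
  = node_of (a *: 'X_[U_(i0) *+ j] + b *: 'X_[U_(i1) *+ j]).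
Proof.
rewrite -!mul_mpolyC -!mpolyXn (rmorphD node_of) !(rmorphM node_of).
by rewrite !(rmorphXn node_of).
Qed.

Lemma node_const_ord1 c : node_ord 1 (node_const 0 c) -> c = 0.
Proof.
move=> /node_ord_axis - /(_ 0%MM); rewrite /on_axis mnm0E eqxx mdeg0 => /(_ isT isT).
by rewrite /pseries_of mcoeffC eqxx mulr1.
Qed.

Lemma node_ordX x j : node_ord 1 x -> node_ord j (x ^+ j).
Proof.
by move=> x1; elim: j => [|j IH]; [apply: node_ord_any|rewrite exprS -add1n; apply: node_ordM].
Qed.

Lemma node_u_ord1 : node_ord 1 node_u.
Proof.
exists (pseries_of 'X_i0) => // m; rewrite ltnS leqn0 mdeg_eq0 => /eqP ->.
by rewrite /pseries_of mcoeffX -mdeg_eq0 mdeg1.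
Qed.

Lemma node_v_ord1 : node_ord 1 node_v.
Proof.
exists (pseries_of 'X_i1) => // m; rewrite ltnS leqn0 mdeg_eq0 => /eqP ->.
by rewrite /pseries_of mcoeffX -mdeg_eq0 mdeg1.
Qed.

(** For [j > 0] the monomials [u ^ j] and [v ^ j] are distinct and lie on the axes, whereas for
    [j = 0] both are [1]. *)
Lemma node_leading j (a b : k) : (0 < j)%N ->
  node_ord j.+1 (node_const 0 a * node_u ^+ j + node_const 0 b * node_v ^+ j) ->
  a = 0 /\ b = 0.
Proof.
move=> j0.
pose f : P := pseries_of (a *: 'X_[U_(i0) *+ j] + b *: 'X_[U_(i1) *+ j]).
rewrite node_leadingE -[node_of _]/(npi f) => /node_ord_axis h; split.
  have := h (U_(i0) *+ j)%MM; rewrite /on_axis !mulmnE !mnm1E eqxx i0_neq_i1 /=.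
  rewrite ?mul0n ?orbT mdegMn mdeg1 mul1n ltnSn => /(_ isT isT).
  rewrite /f /pseries_of mcoeffD !mcoeffZ !mcoeffX eqxx mulr1.
  case: eqP => [/mnmP /(_ i0)|_]; last by rewrite mulr0 addr0.
  by rewrite !mulmnE !mnm1E eqxx [i1 == _]eq_sym i0_neq_i1 ?mul0n mul1n => e; rewrite -e in j0.
have := h (U_(i1) *+ j)%MM; rewrite /on_axis !mulmnE !mnm1E eqxx [i1 == _]eq_sym i0_neq_i1 /=.
rewrite ?mul0n ?eqxx mdegMn mdeg1 mul1n ltnSn => /(_ isT isT).
rewrite /f /pseries_of mcoeffD !mcoeffZ !mcoeffX eqxx mulr1.
case: eqP => [/mnmP /(_ i1)|_]; last by rewrite mulr0 add0r.
by rewrite !mulmnE !mnm1E eqxx i0_neq_i1 ?mul0n mul1n => e; rewrite -e in j0.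
Qed.

Lemma node_split0 x : exists c, node_ord 1 (x - node_const 0 c).
Proof.
have [f ->] := quot_piP x; exists (f 0%MM).
exists (f - pseries_of (f 0%MM)%:MP); last by rewrite (rmorphB npi).
move=> m; rewrite ltnS leqn0 mdeg_eq0 => /eqP ->.
by rewrite -[LHS]/(f 0%MM - (f 0%MM)%:MP@_0) mcoeffC eqxx mulr1 subrr.
Qed.

Lemma node_split j x : (0 < j)%N -> node_ord j x -> exists a b,
  node_ord j.+1 (x - (node_const 0 a * node_u ^+ j + node_const 0 b * node_v ^+ j)).
Proof.
move=> j0 [f fj ->]; set a := f (U_(i0) *+ j)%MM; set b := f (U_(i1) *+ j)%MM.
exists a, b.
pose g : P := pseries_of (a *: 'X_[U_(i0) *+ j] + b *: 'X_[U_(i1) *+ j]).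
(* [h] collects the terms divisible by [uv]. Without it only [u ^ j] and [v ^ j] remain in degree
   [j]. *)
pose h : P := fun m => if on_axis m then 0 else f m.
have h0 : npi h = 0 by apply/node_eq0 => m mx; rewrite /h mx.
exists (f - g - h); last first.
  by rewrite !(rmorphB npi) /= h0 subr0 node_leadingE.
move=> m mj; rewrite -[LHS]/(f m - g m - h m) /g /pseries_of mcoeffD !mcoeffZ !mcoeffX /h.
have [e0|n0] := eqVneq (U_(i0) *+ j)%MM m.
  have -> : (U_(i1) *+ j == m)%MM = false.
    apply/negP; rewrite -e0 => /eqP/mnmP /(_ i1).
    by rewrite !mulmnE !mnm1E eqxx i0_neq_i1 ?mul0n mul1n => e; rewrite e in j0.
  rewrite -e0 /on_axis !mulmnE !mnm1E i0_neq_i1 ?mul0n eqxx orbT -/a.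
  by rewrite mulr1 mulr0 addr0 subr0 subrr.
have [e1|n1] := eqVneq (U_(i1) *+ j)%MM m.
  rewrite -e1 /on_axis !mulmnE !mnm1E [i1 == _]eq_sym i0_neq_i1 ?mul0n eqxx /= -/b.
  by rewrite mulr1 mulr0 add0r subr0 subrr.
rewrite !mulr0 addr0 subr0; case: ifPn => [mx|_]; last by rewrite subrr.
rewrite subr0 fj // ltn_neqAle -ltnS mj andbT; apply/eqP => md.
move: n0 n1; case/orP: mx => /eqP mx.
  move=> _ /eqP[]; apply: mnm2P; rewrite mulmnE mnm1E ?eqxx ?[i1 == _]eq_sym ?i0_neq_i1 ?mx //.
  by rewrite -md mdeg2E mx add0n mul1n.
move=> /eqP[]; apply: mnm2P; rewrite mulmnE mnm1E ?eqxx ?i0_neq_i1 ?mx //.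
by rewrite -md mdeg2E mx addn0 mul1n.
Qed.

(** Up to the constant [c], the element is [1 - t] with [t] of order 1, and the geometric sums of
    [t] converge to an inverse. *)
Lemma node_unit x c : c != 0 -> node_ord 1 (x - node_const 0 c) -> exists y, x * y = 1.
Proof.
move=> c0 h; pose kc c := node_of c%:MP.
pose t := 1 - kc c^-1 * x.
have t1 : node_ord 1 t.
  have -> : t = - (kc c^-1 * (x - kc c)).
    by rewrite mulrBr -rmorphM -mpolyCM mulVf // rmorph1 opprB.
  by apply: node_ordN; apply: node_ordMl.
have [d|z hz] := node_complete (y := fun d => \sum_(i < d) t ^+ i).
  by rewrite big_ord_recr addrC addKr; apply: node_ordX.
exists (kc c^-1 * z); apply/eqP; rewrite -subr_eq0; apply/eqP/node_separated => d.
rewrite mulrCA mulrA (_ : kc c^-1 * x = 1 - t); last by rewrite /t opprB addrC subrK.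
set s := \sum_(i < d) t ^+ i in hz.
have es : (1 - t) * s = 1 - t ^+ d.
  have := subrXX_comm d (commr_sym (commr1 t)); rewrite expr1n => ->; congr (_ * _).
  by apply: eq_bigr => i _; rewrite expr1n mul1r.
have -> : (1 - t) * z - 1 = (1 - t) * (z - s) - t ^+ d by rewrite mulrBr es; ring.
by apply: node_ordB; [apply: node_ordMl|apply: node_ordX].
Qed.

End NodeFiltration.

(** * Completion at a node *)

Section NodeCriterion.
Variables (k : fieldType) (A : comPzRingType) (eta : {rmorphism k -> A}).
Variables (u v : A) (psi : {rmorphism A -> node_ring k 0}).
Hypothesis uv0 : u * v = 0.
Hypothesis gen : forall a, exists c b b', a = eta c + (b * u + b' * v).
Hypothesis psi_eta : forall c, psi (eta c) = node_const 0 c.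
Hypothesis psi_u : psi u = node_u k.
Hypothesis psi_v : psi v = node_v k.

Let N := node_ring k 0.

Definition node_point (a : A) : Prop := node_ord 1 (psi a).
Local Notation p := node_point.

Lemma node_psiE j a b :
  psi (a * u ^+ j + b * v ^+ j) = psi a * node_u k ^+ j + psi b * node_v k ^+ j.
Proof.
by rewrite rmorphD [psi (a * _)]rmorphM [psi (b * _)]rmorphM 2!rmorphXn psi_u psi_v.
Qed.

(** The filtration by powers of [(u, v)] in [A] is pulled back from the node ring. In the induction
    the coefficients of [u ^ j] and [v ^ j] are split by [gen] into a constant and an element of
    [(u, v)]; the mixed terms die by [uv = 0] and the constants by [node_leading]. *)
Lemma node_psi_pow j a : (0 < j)%N -> node_ord j (psi a) ->
  exists b b', a = b * u ^+ j + b' * v ^+ j.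
Proof.
case: j => // j _; elim: j a => [|j IH] a ha.
  have [c [b [b' e]]] := gen a; exists b, b'; rewrite !expr1.
  suff c0 : c = 0 by rewrite e c0 rmorph0 add0r.
  apply: node_const_ord1; rewrite -psi_eta.
  have -> : eta c = a - (b * u + b' * v) by rewrite e addrK.
  rewrite rmorphB rmorphD !rmorphM psi_u psi_v; apply: node_ordB => //.
  by apply: node_ordD; apply: node_ordMl; [apply: node_u_ord1|apply: node_v_ord1].
have [b [b' e]] := IH a (node_ordW (leqnSn _) ha).
have [c [b1 [b2 eb]]] := gen b; have [c' [b1' [b2' eb']]] := gen b'.
have uvj i : u ^+ i.+1 * v = 0 by rewrite exprSr -mulrA uv0 mulr0.
have vuj i : v ^+ i.+1 * u = 0 by rewrite exprSr -mulrA [v * u]mulrC uv0 mulr0.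
have e' : a = (eta c * u ^+ j.+1 + eta c' * v ^+ j.+1)
              + (b1 * u ^+ j.+2 + b2' * v ^+ j.+2).
  rewrite e eb eb' ![_ ^+ j.+2]exprS.
  have -> : (eta c + (b1 * u + b2 * v)) * u ^+ j.+1 =
    eta c * u ^+ j.+1 + b1 * (u * u ^+ j.+1) + b2 * (u ^+ j.+1 * v) by ring.
  have -> : (eta c' + (b1' * u + b2' * v)) * v ^+ j.+1 =
    eta c' * v ^+ j.+1 + b2' * (v * v ^+ j.+1) + b1' * (v ^+ j.+1 * u) by ring.
  by rewrite uvj vuj; ring.
have [||c0 c'0] := @node_leading k j.+1 c c'; first by [].
  have -> : node_const 0 c * node_u k ^+ j.+1 + node_const 0 c' * node_v k ^+ j.+1
    = psi a - psi (b1 * u ^+ j.+2 + b2' * v ^+ j.+2).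
    by rewrite -rmorphB e' addrK node_psiE !psi_eta.
  apply: node_ordB => //; rewrite node_psiE.
  by apply: node_ordD; apply: node_ordMl; apply: node_ordX;
    [apply: node_u_ord1|apply: node_v_ord1].
by exists b1, b2'; rewrite e' c0 c'0 rmorph0 !mul0r !add0r.
Qed.

Lemma node_point_eta c : p (eta c) -> c = 0.
Proof. by rewrite /p psi_eta => /node_const_ord1. Qed.

Lemma node_point_maximal : maximal_ideal p.
Proof.
split.
- split; first by rewrite /p rmorph0; apply: node_ord0.
  + by move=> x y px py; rewrite /p rmorphD; apply: node_ordD.
  + by move=> a x px; rewrite /p rmorphM; apply: node_ordMl.
- by rewrite -(rmorph1 eta) => /node_point_eta /eqP; rewrite oner_eq0.
move=> J [J0 JD JM] pJ J1 x Jx.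
have [c [b [b' e]]] := gen x.
have pb : p (b * u + b' * v).
  rewrite /p rmorphD !rmorphM psi_u psi_v.
  by apply: node_ordD; apply: node_ordMl; [apply: node_u_ord1|apply: node_v_ord1].
have [c0|c0] := eqVneq c 0; first by rewrite e c0 rmorph0 add0r.
case: J1; rewrite -(rmorph1 eta) -(mulVf c0) rmorphM; apply: (JM).
have -> : eta c = x + (-1) * (b * u + b' * v) by rewrite e; ring.
by apply: JD => //; apply/JM/pJ.
Qed.

Lemma node_point_unit s : ~ p s -> exists y, psi s * y = 1.
Proof.
move=> ps; have [c hc] := node_split0 (psi s).
apply: (node_unit _ hc); apply/eqP => c0; apply: ps.
by move: hc; rewrite c0 -psi_eta !rmorph0 subr0.
Qed.

Let L := local_ring p.
Definition node_local_map : {rmorphism L -> N} :=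
  [the {rmorphism _ -> _} of loc_lift node_point_unit].
Local Notation psiL := node_local_map.

Lemma node_local_mapE a : psiL (loc_map _ a) = psi a.
Proof. exact: loc_lift_map. Qed.

(** Cauchy and null sequences can thus be tested in the node ring. For the converse, a fraction
    [x = a / s] satisfies [psi a = psi s * psiL x], so [node_psi_pow] applies to the numerator. *)
Lemma node_local_pow j x : ideal_pow (@local_max A p) j x <-> node_ord j (psiL x).
Proof.
have [i0 iD iM] := ideal_span_is_ideal (fun a => exists s : seq L,
  [/\ size s = j, forall x, x \in s -> local_max x & a = \prod_(x <- s) x]).
split=> [[s [sX ->]]|].
  rewrite rmorph_sum big_seq; apply: (big_ind (node_ord j)) => [||q /sX].
  - exact: node_ord0.
  - exact: node_ordD.
  case=> t [<- tm e]; rewrite rmorphM e; apply: node_ordMl.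
  elim: t tm {e} => [|y t IH] tm; first exact: node_ord_any.
  rewrite big_cons rmorphM /= -add1n; apply: node_ordM; last first.
    by apply: IH => z zt; apply: tm; rewrite inE zt orbT.
  have [r [rp ->]] := tm y (mem_head _ _).
  rewrite rmorph_sum big_seq; apply: (big_ind (node_ord 1)) => [||q' /rp].
  - exact: node_ord0.
  - exact: node_ordD.
  by case=> a pa ->; rewrite rmorphM node_local_mapE; apply: node_ordMl.
have [[a s] ->] := loc_piP x.
pose w : L := loc_pi (1, s).
have ex : loc_pi (a, s) = loc_map _ a * w.
  rewrite loc_piM; apply: loc_pi_eqW.
  by change (a * (1 * den_val s) = a * 1 * den_val s); ring.
have ew : loc_map _ (den_val s) * w = 1.
  rewrite -(rmorph1 (@loc_map A (fun a => ~ p a))) loc_piM; apply: loc_pi_eqW.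
  by change (den_val s * 1 * 1 = 1 * (1 * den_val s)); ring.
have genu b : p b -> forall i, ideal_pow (@local_max A p) i (loc_map _ (b ^+ i)).
  move=> pb i; apply: ideal_span_gen; exists (nseq i (loc_map _ b)).
  rewrite size_nseq; split=> // [y|].
    rewrite mem_nseq => /andP[_ /eqP ->]; apply: ideal_span_gen; by exists b.
  by rewrite rmorphXn big_nseq -Monoid.iteropE.
have hw : psi (den_val s) * psiL w = 1.
  by have := congr1 psiL ew; rewrite [LHS]rmorphM rmorph1 node_local_mapE.
rewrite ex => h; have {h} : node_ord j (psi a).
  move: (den_val s) hw => b hw.
  have -> : psi a = psi b * psiL (loc_map _ a * w).
    by rewrite [psiL _]rmorphM node_local_mapE mulrCA hw mulr1.
  exact: node_ordMl.
(* [node_psi_pow] needs a positive exponent; the zeroth power is the whole ring. *)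
rewrite mulrC => h; apply: (iM); case: (posnP j) h => [j0 _|j0 h].
  rewrite -[a]mulr1 rmorphM; apply: (iM); rewrite j0; apply: (genu 0).
  by rewrite /p rmorph0; apply: node_ord0.
have [b [b' ->]] := node_psi_pow j0 h.
by rewrite rmorphD !rmorphM; apply: (iD); apply: (iM); apply: genu;
  rewrite /p ?psi_u ?psi_v; [apply: node_u_ord1|apply: node_v_ord1].
Qed.

(** * The limit map from Cauchy sequences to the node ring *)

Local Notation cauchy := (cauchy_seq (@local_max A p)).

Definition node_limit (x : cauchy) (z : N) : Prop :=
  forall j, exists M, forall i, (M <= i)%N -> node_ord j (z - psiL (\val x i)).

Lemma node_limit_exists x : exists z, node_limit x z.
Proof.
have /asboolP cx := valP x.
have /choice[M hM] j : exists M, forall i i', (M <= i)%N -> (M <= i')%N ->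
    node_ord j (psiL (\val x i) - psiL (\val x i')).
  have [M hM] := cx j; exists M => i i' Mi Mi'.
  by rewrite -rmorphB; apply/node_local_pow; apply: hM.
(* Sums of the moduli are used so that both [ix j] and [ix j.+1] are past [M j]. *)
pose ix j := (\sum_(i < j.+1) M i)%N.
have Mix j : (M j <= ix j)%N by rewrite /ix big_ord_recr leq_addl.
have [d|z hz] := node_complete (y := fun j => psiL (\val x (ix j))).
  apply: hM => //; apply: leq_trans (Mix d) _.
  by rewrite [X in (_ <= X)%N]/ix big_ord_recr leq_addr.
exists z => j; exists (M j) => i Mi.
rewrite -(subrKA (psiL (\val x (ix j)))).
exact: node_ordD (hz j) (hM j _ _ (Mix j) Mi).
Qed.

Lemma node_limit_unique x z z' : node_limit x z -> node_limit x z' -> z = z'.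
Proof.
move=> h h'; apply/eqP; rewrite -subr_eq0; apply/eqP/node_separated => d.
have [M hM] := h d; have [M' hM'] := h' d.
rewrite -(subrKA (psiL (\val x (M + M')))) .
apply: (node_ordD (hM _ (leq_addr _ _))); rewrite -opprB.
exact: node_ordN (hM' _ (leq_addl _ _)).
Qed.

Definition node_lim (x : cauchy) : N := projT1 (cid (node_limit_exists x)).

Lemma node_limP x : node_limit x (node_lim x).
Proof. by rewrite /node_lim; case: cid. Qed.

Lemma node_limE x z : node_limit x z -> node_lim x = z.
Proof. exact: node_limit_unique (node_limP x). Qed.

Fact node_lim_zmod_morphism : zmod_morphism node_lim.
Proof.
move=> x y; apply: node_limE => j.
have [M hM] := node_limP x j; have [M' hM'] := node_limP y j.
exists (maxn M M') => i; rewrite geq_max => /andP[Mi Mi'].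
have -> : psiL (\val (x - y) i) = psiL (\val x i) - psiL (\val y i) by exact: (rmorphB psiL).
move: (node_lim x) (node_lim y) (psiL (\val x i)) (psiL (\val y i)) (hM _ Mi) (hM' _ Mi')
  => a b a' b' ha hb.
rewrite (_ : _ - _ - _ = (a - a') - (b - b')); first exact: node_ordB.
by ring.
Qed.

Fact node_lim_monoid_morphism : monoid_morphism node_lim.
Proof.
split.
  by apply: node_limE => j; exists 0%N => i _; rewrite rmorph1 subrr; apply: node_ord0.
move=> x y; apply: node_limE => j.
have [M hM] := node_limP x j; have [M' hM'] := node_limP y j.
exists (maxn M M') => i; rewrite geq_max => /andP[Mi Mi'].
rewrite (rmorphM \val) -[(_ * _) i]/(\val x i * \val y i).
rewrite [psiL (_ * _)]rmorphM.
move: (node_lim x) (node_lim y) (psiL (\val x i)) (psiL (\val y i)) (hM _ Mi) (hM' _ Mi')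
  => a b a' b' ha hb.
rewrite (_ : _ - _ = b * (a - a') + a' * (b - b')); last by ring.
exact: node_ordD (node_ordMl _ ha) (node_ordMl _ hb).
Qed.

HB.instance Definition _ :=
  GRing.isZmodMorphism.Build cauchy N node_lim node_lim_zmod_morphism.
HB.instance Definition _ :=
  GRing.isMonoidMorphism.Build cauchy N node_lim node_lim_monoid_morphism.

(** One direction makes the limit map descend to the completion, the other makes the descended map
    injective. *)
Lemma node_lim_null x : is_null (@local_max A p) (\val x) <-> node_lim x = 0.
Proof.
split=> [h|h j]; last first.
  have [M hM] := node_limP x j; exists M => i /hM.
  by rewrite h sub0r => /node_ordN; rewrite opprK => /node_local_pow.
apply: node_limE => j; have [M hM] := h j; exists M => i /hM.
by move=> /node_local_pow; rewrite sub0r; apply: node_ordN.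
Qed.

(** The image of [A] contains the constants, [u] and [v], so the part of each degree can be
    corrected in turn. *)
Lemma node_dense z d : exists a, node_ord d (z - psi a).
Proof.
elim: d => [|[|d] [a ha]]; first by exists 0; apply: node_ord_any.
  by have [c hc] := node_split0 z; exists (eta c); rewrite psi_eta.
have [b [b' h]] := node_split (ltn0Sn d) ha.
exists (a + (eta b * u ^+ d.+1 + eta b' * v ^+ d.+1)).
by rewrite rmorphD node_psiE !psi_eta opprD addrA.
Qed.

Lemma node_lim_surj z : exists x, node_lim x = z.
Proof.
have /choice[a ha] := node_dense z.
have cx : (fun i => loc_map _ (a i)) \in cauchyb (@local_max A p).
  apply/asboolP => j; exists j => i i' ji ji'; apply/node_local_pow.
  rewrite rmorphB !node_local_mapE.
  have -> : psi (a i) - psi (a i') = (z - psi (a i')) - (z - psi (a i)) by ring.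
  exact: node_ordB (node_ordW ji' (ha _)) (node_ordW ji (ha _)).
exists (exist (fun x => is_true (x \in cauchyb _)) _ cx).
apply: node_limE => j; exists j => i ji /=.
by rewrite node_local_mapE; exact: node_ordW ji (ha _).
Qed.

Lemma node_criterion : has_nodal_singularities eta.
Proof.
exists p; first exact: node_point_maximal.
have null0 x : is_null (@local_max A p) (\val x) -> node_lim x = 0.
  by move/node_lim_null.
pose phi : {rmorphism completed_local_ring p -> N} :=
  [the {rmorphism _ -> _} of quot_lift null0].
(* The completed ring is that of a plane node, without smooth variables [z_i]. *)
exists 0%N, phi; split=> [|c].
  have surj z : exists q, phi q = z.
    have [x <-] := node_lim_surj z.
    by exists (quot_pi _ x); apply: quot_liftE.
  have /choice[g hg] := surj.
  have inj : injective phi.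
    apply: raddf_inj => q; have [x ->] := quot_piP q.
    move=> e; have /node_lim_null x0 : node_lim x = 0.
      by rewrite -e; symmetry; apply: quot_liftE.
    rewrite -(rmorph0 (@quot_pi _ _)); apply/quot_pi_eq.
    by rewrite subr0; apply: ideal_span_gen.
  by exists g => // q; apply: inj; rewrite hg.
rewrite -psi_eta [LHS]quot_liftE; apply: node_limE => j; exists 0%N => i _.
by rewrite /= node_local_mapE subrr; apply: node_ord0.
Qed.

End NodeCriterion.

(** * Minors of matrices with three rows *)

Local Notation r0 := (@Ordinal 3 0 isT).
Local Notation r1 := (@Ordinal 3 1 isT).
Local Notation r2 := (@Ordinal 3 2 isT).

Section Det3.
Variable R : comPzRingType.

Definition det3 (p q r : 'I_3 -> R) : R :=
  p r0 * (q r1 * r r2 - q r2 * r r1) - p r1 * (q r0 * r r2 - q r2 * r r0)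
  + p r2 * (q r0 * r r1 - q r1 * r r0).

Lemma det_mx33 (A : 'M[R]_3) : \det A = det3 (A^~ r0) (A^~ r1) (A^~ r2).
Proof.
pose g a b := A (inord a) (inord b).
have E i j : A i j = g i j by rewrite /g !inord_val.
rewrite (expand_det_col _ ord0) !big_ord_recl big_ord0 /cofactor.
rewrite !(expand_det_col _ ord0) !big_ord_recl !big_ord0 /cofactor.
rewrite !det_mx11 !mxE /det3 !E /= /bump /=.
by rewrite !addn0 ?add0n !addn1 !expr1 ?expr0 ?exprS ?expr0; ring.
Qed.

Lemma det3_scale (c0 c1 c2 : R) (s : 'I_3 -> R) (p q r p' q' r' : 'I_3 -> R) :
  (forall i, p' i = c0 * (s i * p i)) -> (forall i, q' i = c1 * (s i * q i)) ->
  (forall i, r' i = c2 * (s i * r i)) ->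
  det3 p' q' r' = c0 * c1 * c2 * (s r0 * s r1 * s r2) * det3 p q r.
Proof. by move=> hp hq hr; rewrite /det3 !hp !hq !hr; ring. Qed.

End Det3.

Lemma rmorph_det3 (R S : comPzRingType) (f : {rmorphism R -> S}) p q r :
  f (det3 p q r) = det3 (f \o p) (f \o q) (f \o r).
Proof. by rewrite /det3 /= !(rmorphD, rmorphN, rmorphM). Qed.

Lemma cards3E (T : finType) (l : {set T}) : #|l| = 3 ->
  exists a b c, uniq [:: a; b; c] /\ l = [set a; b; c].
Proof.
move=> l3; have := enum_uniq l; have := l3; rewrite cardE => s3.
have memE x : (x \in l) = (x \in enum l) by rewrite mem_enum.
case: (enum l) s3 memE => [|a [|b [|c [|]]]] // _ memE u; exists a, b, c; split=> //.
by apply/setP => x; rewrite memE !inE orbA.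
Qed.

(** The minor lists its columns in increasing order, so it differs from [det3] by the sign of the
    permutation sorting [a, b, c]. The sign is chosen before the ring and the matrix, hence is
    compatible with ring morphisms. *)
Lemma minor3 n (a b c : 'I_n) : uniq [:: a; b; c] ->
  exists s : bool, forall (R : comPzRingType) (M : 'I_3 -> 'I_n -> R),
    \det (\matrix_(i < 3, j < 3) [seq M i k | k <- enum [set a; b; c]]`_j)
    = (-1) ^+ s * det3 (M^~ a) (M^~ b) (M^~ c).
Proof.
move=> u.
have eqm x : (x \in enum [set a; b; c]) = (x \in [:: a; b; c]).
  by rewrite mem_enum !inE orbA.
have := enum_uniq [set a; b; c].
have : size (enum [set a; b; c]) = 3.
  by rewrite (perm_size (uniq_perm (enum_uniq _) u eqm)).
case: (enum _) eqm => [|x [|y [|z [|]]]] // eqm _.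
have := eqm x; have := eqm y; have := eqm z; rewrite !inE !eqxx !orbT.
move: u; rewrite /= !inE !negb_or !andbT => /andP[/andP[ab ac] bc].
case/esym/or3P => /eqP ->; case/esym/or3P => /eqP ->; case/esym/or3P => /eqP ->;
  rewrite ?eqxx ?andbF ?orbT //= => _.
(* The parities of the six possible orders. *)
all: [> exists true| exists false|exists false|exists true|exists true|exists false].
all: move=> R M; rewrite det_mx33 /det3 !mxE /= ?expr1 ?expr0; ring.
Qed.

(** * Universal property of the stratum ring *)

Lemma mpoly_gen (n : nat) (k : comNzRingType) (P : {mpoly k[n]} -> Prop) :
  (forall c, P c%:MP) -> (forall i, P 'X_i) -> (forall p q, P p -> P q -> P (p + q)) ->
  (forall p q, P p -> P q -> P (p * q)) -> forall p, P p.
Proof.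
move=> PC PX PD PM p; rewrite [p]mpolyE; apply: (big_ind P) => // [|m _].
  by rewrite -mpolyC0.
rewrite -mul_mpolyC; apply: (PM) => //; rewrite mpolyXE_id.
apply: (big_ind P) => // [|i _]; first by rewrite -mpolyC1.
by elim: (m i) => [|j IH]; rewrite ?expr0 -?mpolyC1 // exprS; apply: PM.
Qed.

Lemma mpoly_rmorph_eq (n : nat) (k : comNzRingType) (A : comPzRingType)
    (f g : {rmorphism {mpoly k[n]} -> A}) :
  (forall c, f c%:MP = g c%:MP) -> (forall i, f 'X_i = g 'X_i) -> f =1 g.
Proof.
move=> fgC fgX; apply: mpoly_gen => // p q hp hq; first by rewrite !rmorphD hp hq.
by rewrite !rmorphM hp hq.
Qed.

(* [mmap] needs a nonzero target ring. *)
Lemma mpoly_eval (n : nat) (k : comNzRingType) (A : comPzRingType)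
    (eta : {rmorphism k -> A}) (h : 'I_n -> A) :
  exists f : {rmorphism {mpoly k[n]} -> A},
    (forall c, f c%:MP = eta c) /\ (forall i, f 'X_i = h i).
Proof.
have [A0|A1] := eqVneq (1 : A) 0.
  have all0 (a b : A) : a = b by rewrite -[a]mul1r -[b]mul1r A0 !mul0r.
  exists [the {rmorphism _ -> _} of eta \o meval (fun _ : 'I_n => 0 : k)].
  by split=> *; apply: all0.
pose A' : comNzRingType := HB.pack_for comNzRingType A (GRing.PzSemiRing_isNonZero.Build A A1).
pose eta' : {rmorphism k -> A'} := eta.
pose h' : 'I_n -> A' := h.
pose f : {rmorphism {mpoly k[n]} -> A'} := [the {rmorphism _ -> _} of mmap eta' h'].
exists (f : {rmorphism {mpoly k[n]} -> A}); split=> [c|i]; first exact: (@mmapC n k A' h' eta' c).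
exact: etrans (@mmapX n k A' h' eta' U_(i)%MM) (@mmap1U n A' h' i).
Qed.

Section Universal.
Variables (F : fieldType) (n : nat) (Q : matroid 3 n).
Local Notation S := (stratum_ring F Q).

Definition chart_entry (i : 'I_3) (k : 'I_n) : S :=
  loc_map _ (quot_pi _ (chart_matrix F Q i k)).
Local Notation U := chart_entry.

Lemma chart_map_minor (A : comPzRingType) (f : {rmorphism chart_ring F Q -> A})
    (a b c : 'I_n) : uniq [:: a; b; c] ->
  exists s : bool, f (plucker (chart_matrix F Q) [set a; b; c])
    = (-1) ^+ s * det3 (fun i => f (chart_matrix F Q i a))
      (fun i => f (chart_matrix F Q i b)) (fun i => f (chart_matrix F Q i c)).
Proof.
move=> u; have [s hs] := minor3 u; exists s.
rewrite /plucker (hs _ (fun i k => chart_matrix F Q i k)) rmorphM rmorphXn rmorphN1.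
by rewrite rmorph_det3.
Qed.

Definition stratum_map : {rmorphism chart_ring F Q -> S} :=
  [the {rmorphism _ -> _} of
    @loc_map _ (@basis_minor F 3 n Q) \o @quot_pi _ (@nonbasis_minor F 3 n Q)].

Lemma chart_entry_initial i (k : 'I_n) : (k < 3)%N -> U i k = (k == i :> nat)%:R.
Proof.
by move=> k3; rewrite -[U i k]/(stratum_map _) mxE k3 rmorph_nat.
Qed.

Lemma chart_entry_nonbasis (a b c : 'I_n) : uniq [:: a; b; c] ->
  [set a; b; c] \notin bases Q -> det3 (U^~ a) (U^~ b) (U^~ c) = 0.
Proof.
move=> u ab; have [s hs] := chart_map_minor stratum_map u.
move: hs; rewrite [LHS]/= (_ : quot_pi _ _ = 0).
  by rewrite rmorph0 => /(congr1 (fun x => (-1) ^+ s * x)); rewrite mulr0 signrMK.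
rewrite -(rmorph0 (@quot_pi _ _)); apply/quot_pi_eq.
rewrite subr0; apply: ideal_span_gen; exists [set a; b; c]; split=> //.
transitivity #|[:: a; b; c]|; last exact/card_uniqP.
by apply: eq_card => x; rewrite !inE orbA.
Qed.

Lemma chart_entry_basis (a b c : 'I_n) : uniq [:: a; b; c] ->
  [set a; b; c] \in bases Q -> exists y, det3 (U^~ a) (U^~ b) (U^~ c) * y = 1.
Proof.
move=> u ab; have [s hs] := chart_map_minor stratum_map u.
have [|y hy] := @loc_map_inv _ (@basis_minor F 3 n Q)
  (quot_pi _ (plucker (chart_matrix F Q) [set a; b; c])).
  by exists [set a; b; c].
exists ((-1) ^+ s * y); rewrite -[RHS]hy mulrCA mulrA; congr (_ * _); symmetry; exact: hs.
Qed.

Section Lift.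
Variables (A : comPzRingType) (eta : {rmorphism F -> A}) (Y : 'I_3 -> 'I_n -> A).
Hypothesis Y_initial : forall i (k : 'I_n), (k < 3)%N -> Y i k = (k == i :> nat)%:R.
Hypothesis Y_nonbasis : forall a b c : 'I_n, uniq [:: a; b; c] ->
  [set a; b; c] \notin bases Q -> det3 (Y^~ a) (Y^~ b) (Y^~ c) = 0.
Hypothesis Y_basis : forall a b c : 'I_n, uniq [:: a; b; c] ->
  [set a; b; c] \in bases Q -> exists y, det3 (Y^~ a) (Y^~ b) (Y^~ c) * y = 1.

Local Notation o := (row_index Q).

(** The chart matrix has a zero in such a place. For [Y] this follows from a nonbasis minor: column
    [k] together with the two unit columns other than [i] has determinant [Y i k] up to sign. *)
Lemma Y_exchange i (k : 'I_n) : (3 <= k)%N -> exchange i k \notin bases Q -> Y i k = 0.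
Proof.
move=> k3.
have ok j : (k == o j) = false.
  by apply/negP => /eqP e; have := ltn_ord j; rewrite -[val j]/(val (o j)) -e ltnNge k3.
have oo j j' : (o j == o j') = (j == j') by rewrite -val_eqE.
have u a b : a != b -> uniq [:: k; o a; o b] by move=> ab; rewrite /= !inE !ok oo ab.
have Yo j a : Y j (o a) = (a == j)%:R.
  by rewrite -val_eqE; apply: Y_initial; apply: (ltn_ord a).
have ex a b : a != b -> a != i -> b != i -> exchange i k = [set k; o a; o b].
  move=> ab ai bi; apply/setP => x; rewrite !inE -orbA; congr (_ || _).
  rewrite -!val_eqE /=; move: ab ai bi; rewrite -!val_eqE /=.
  move: (val i) (val a) (val b) (ltn_ord i) (ltn_ord a) (ltn_ord b).
  by do 3![case=> [|[|[|//]]]]; case: (val x) => [|[|[|]]].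
move=> exQ.
have YE a b : a != b -> a != i -> b != i ->
    det3 (Y^~ k) (Y^~ (o a)) (Y^~ (o b)) = 0.
  by move=> ab ai bi; apply: Y_nonbasis; rewrite ?u // -ex.
case: (i) YE => [[|[|[|?]]] hi] // YE.
- have := YE r1 r2 isT isT isT; rewrite /det3 !Yo /= => e.
  rewrite -e (_ : Ordinal hi = r0); last exact: val_inj.
  ring.
- have := YE r0 r2 isT isT isT; rewrite /det3 !Yo /= => e.
  rewrite -[LHS]opprK -[RHS]oppr0 -e (_ : Ordinal hi = r1); last exact: val_inj.
  ring.
have := YE r0 r1 isT isT isT; rewrite /det3 !Yo /= => e.
rewrite -e (_ : Ordinal hi = r2); last exact: val_inj.
ring.
Qed.

(** The universal property of [S_Q]: a matrix with the right minors defines a map on the polynomial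
    ring, which passes to the quotient by the nonbasis minors and then to the localization at the
    basis minors. *)
Lemma stratum_lift : exists f : {rmorphism S -> A},
  (forall c, f (stratum_const F Q c) = eta c) /\ (forall i k, f (U i k) = Y i k).
Proof.
have [f0 [f0C f0X]] := mpoly_eval eta
  (fun v : 'I_#|{: chart_var Q}| => Y (\val (enum_val v)).1 (\val (enum_val v)).2).
have f0M i k : f0 (chart_matrix F Q i k) = Y i k.
  rewrite mxE; case: ifPn => [k3|]; first by rewrite Y_initial // rmorph_nat.
  rewrite -leqNgt => k3; case: insubP => [v _ ev|]; first by rewrite f0X enum_rankK ev.
  by rewrite negb_and k3 /= rmorph0 => /Y_exchange ->.
have f0m (a b c : 'I_n) : uniq [:: a; b; c] -> exists s : bool,
    f0 (plucker (chart_matrix F Q) [set a; b; c])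
    = (-1) ^+ s * det3 (Y^~ a) (Y^~ b) (Y^~ c).
  move=> u; have [s ->] := chart_map_minor f0 u; exists s.
  by congr (_ * _); rewrite /det3 !f0M.
have f1 f : nonbasis_minor f -> f0 f = 0.
  case=> l [/cards3E[a [b [c [u el]]]] lQ ->]; subst l.
  by have [s ->] := f0m a b c u; rewrite Y_nonbasis ?mulr0.
have f2 q : basis_minor q -> exists y, quot_lift f1 q * y = 1.
  case=> l lQ ->; rewrite quot_liftE.
  have /cards3E[a [b [c [u el]]]] := bases_rank lQ; subst l.
  have [s ->] := f0m a b c u; have [y hy] := Y_basis u lQ.
  by exists ((-1) ^+ s * y); rewrite mulrACA hy mulr1 -expr2 sqrr_sign.
exists [the {rmorphism _ -> _} of loc_lift f2]; split=> [c|i k].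
  by rewrite [LHS]loc_lift_map [LHS]quot_liftE f0C.
by rewrite [LHS]loc_lift_map [LHS]quot_liftE f0M.
Qed.

End Lift.
End Universal.

(** * Polynomial functions over an infinite field *)

Section PolynomialFunctions.
Variable S : comPzRingType.
Implicit Types (s r : seq S) (f g : S -> S).

Definition polyfun f := exists s, forall y, f y = \sum_(j < size s) s`_j * y ^+ j.

Lemma polyfun_cst a : polyfun (fun=> a).
Proof. by exists [:: a] => y; rewrite big_ord1 mulr1. Qed.

Lemma polyfun_shift a f : polyfun f -> polyfun (fun y => a + y * f y).
Proof.
case=> s hs; exists (a :: s) => y; rewrite big_ord_recl /= mulr1 hs mulr_sumr.
by congr (_ + _); apply: eq_bigr => j _; rewrite exprS mulrCA.
Qed.

Lemma polyfun_id : polyfun id.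
Proof.
have [s hs] := polyfun_shift 0 (polyfun_cst 1).
by exists s => y; rewrite -hs mulr1 add0r.
Qed.

Lemma polyfun_ind (P : (S -> S) -> Prop) :
  (forall f g, f =1 g -> P f -> P g) -> P (fun=> 0) ->
  (forall a f, polyfun f -> P f -> P (fun y => a + y * f y)) ->
  forall f, polyfun f -> P f.
Proof.
move=> Pext P0 PS f [s hs]; elim: s f hs => [|a s IH] f hs.
  by apply: (Pext _ _ _ P0) => y; rewrite hs big_ord0.
pose g y := \sum_(j < size s) s`_j * y ^+ j.
have pg : polyfun g by exists s.
have Pg : P g by apply: IH.
apply: (Pext _ _ _ (PS a g pg Pg)) => y.
rewrite hs big_ord_recl /= mulr1 mulr_sumr; congr (_ + _).
by apply: eq_bigr => j _; rewrite exprS mulrCA.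
Qed.

Lemma polyfun_ext f g : f =1 g -> polyfun f -> polyfun g.
Proof. by move=> fg [s hs]; exists s => y; rewrite -fg hs. Qed.

Lemma polyfunD f g : polyfun f -> polyfun g -> polyfun (fun y => f y + g y).
Proof.
move=> pf; move: f pf g.
apply: (polyfun_ind (P := fun f => forall g, polyfun g -> polyfun (fun y => f y + g y)))
  => [f1 f2 f12 IH g|g|a f1 _ IH g] pg.
- by apply: polyfun_ext (IH _ pg) => y; rewrite f12.
- by apply: polyfun_ext pg => y; rewrite add0r.
case: pg => -[|b s] hs.
  apply: polyfun_ext (polyfun_shift a (IH _ (polyfun_cst 0))) => y.
  by rewrite hs big_ord0 !addr0.
have ps : polyfun (fun y => \sum_(j < size s) s`_j * y ^+ j) by exists s.
apply: polyfun_ext (polyfun_shift (a + b) (IH _ ps)) => y.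
rewrite hs big_ord_recl /= mulr1 mulrDr -!addrA; congr (_ + _).
rewrite [RHS]addrCA; congr (_ + (_ + _)); rewrite mulr_sumr.
by apply: eq_bigr => j _; rewrite exprS mulrCA.
Qed.

Lemma polyfunZ a f : polyfun f -> polyfun (fun y => a * f y).
Proof.
case=> s hs; exists [seq a * x | x <- s] => y; rewrite hs mulr_sumr size_map.
by apply: eq_bigr => j _; rewrite (nth_map 0) // mulrA.
Qed.

Lemma polyfunM f g : polyfun f -> polyfun g -> polyfun (fun y => f y * g y).
Proof.
move=> pf; move: f pf g.
apply: (polyfun_ind (P := fun f => forall g, polyfun g -> polyfun (fun y => f y * g y)))
  => [f1 f2 f12 IH g|g|a f1 _ IH g] pg.
- by apply: polyfun_ext (IH _ pg) => y; rewrite f12.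
- by apply: polyfun_ext (polyfun_cst 0) => y; rewrite mul0r.
apply: polyfun_ext (polyfunD (polyfunZ a pg) (polyfun_shift 0 (IH _ pg))) => y.
by rewrite add0r mulrDl mulrA.
Qed.

(* If [f] has degree [M], the combination [f (2 t) - 2 ^ M f t] has smaller degree. *)
Lemma polyfun_eq0 (F : numFieldType) (eta : {rmorphism F -> S}) f : polyfun f ->
  (forall t, t != 0 -> f (eta t) = 0) -> f =1 fun=> 0.
Proof.
case=> s hs f0.
suff s0 M (d : nat -> S) : (forall t, t != 0 -> \sum_(j < M) d j * eta t ^+ j = 0) ->
    forall j, (j < M)%N -> d j = 0.
  move=> y; rewrite hs big1 // => j _.
  by rewrite (s0 (size s) (nth 0 s)) ?mul0r // => t /f0; rewrite hs.
elim: M d => // M IH d d0.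
have dj j : (j < M)%N -> d j = 0.
  move=> jM; have := IH (fun j => eta (2 ^+ j - 2 ^+ M) * d j).
  move=> /(_ _ j jM) IHj.
  have u : 2 ^+ j - 2 ^+ M != 0 :> F.
    by rewrite subr_eq0 lt_eqF // ltr_eXn2l // ltr1n.
  rewrite -[d j]mul1r -(rmorph1 eta) -(mulVf u) rmorphM -mulrA IHj ?mulr0 // => t t0.
  transitivity (\sum_(i < M.+1) d i * eta (2 * t) ^+ i
                - eta (2 ^+ M) * \sum_(i < M.+1) d i * eta t ^+ i); last first.
    by rewrite !d0 ?mulr0 ?subrr ?mulf_neq0 ?pnatr_eq0.
  rewrite !big_ord_recr /= mulrDr opprD addrACA.
  rewrite (_ : _ * _ - _ = 0) ?addr0; last first.
    by rewrite [eta (2 * t)]rmorphM [eta (2 ^+ M)]rmorphXn exprMn; ring.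
  rewrite mulr_sumr -sumrB; apply: eq_bigr => i _.
  rewrite [eta (2 * t)]rmorphM [eta (_ - _)]rmorphB [eta (2 ^+ i)]rmorphXn exprMn.
  by ring.
move=> j; rewrite ltnS leq_eqVlt => /orP[/eqP ->|/dj //].
have := d0 1 (oner_neq0 _); rewrite big_ord_recr /= rmorph1 expr1n mulr1 big1 ?add0r // => i _.
by rewrite dj ?mul0r.
Qed.

End PolynomialFunctions.

(** * Torus invariants and normal forms *)

Section TorusInvariants.
Variables (F : numFieldType) (n : nat) (Q : matroid 3 n).
Local Notation S := (stratum_ring F Q).
Local Notation U := (@chart_entry F n Q).
Local Notation eta := (stratum_const F Q).
Local Notation pi := (stratum_map F Q).
Local Notation col v := (\val (enum_val (v : 'I_#|{: chart_var Q}|))).2.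
Local Notation row v := (row_index Q (\val (enum_val (v : 'I_#|{: chart_var Q}|))).1).
Implicit Types (z : 'I_n -> S) (f g : chart_ring F Q).

Fact chart_eval_exists z : exists ev : {rmorphism chart_ring F Q -> S},
  (forall c, ev c%:MP = eta c) /\ (forall v, ev 'X_v = z (col v) * z (row v) * pi 'X_v).
Proof. exact: mpoly_eval. Qed.

(* A torus point with inverted first three coordinates acts by multiplying     *)
(* [x_ik] by [z i * z k], so that the action is polynomial in [z].             *)
Definition chart_eval z : {rmorphism chart_ring F Q -> S} :=
  projT1 (cid (chart_eval_exists z)).

Lemma chart_evalC z c : chart_eval z c%:MP = eta c.
Proof. by rewrite /chart_eval; case: cid => ev []. Qed.

Lemma chart_evalX z v : chart_eval z 'X_v = z (col v) * z (row v) * pi 'X_v.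
Proof. by rewrite /chart_eval; case: cid => ev []. Qed.

Definition set_coord z (k : 'I_n) (y : S) : 'I_n -> S := fun j => if j == k then y else z j.

Lemma chart_eval_polyfun z k f : polyfun (fun y => chart_eval (set_coord z k y) f).
Proof.
move: f; apply: mpoly_gen => [c|v|p q hp hq|p q hp hq].
- by apply: polyfun_ext (polyfun_cst (eta c)) => y; rewrite chart_evalC.
- have pz j : polyfun (fun y => set_coord z k y j).
    rewrite /set_coord; case: (j == k); [exact: polyfun_id|exact: polyfun_cst].
  apply: polyfun_ext (polyfunM (polyfunM (pz (col v)) (pz (row v))) (polyfun_cst (pi 'X_v))).
  by move=> y; rewrite chart_evalX.
- by apply: polyfun_ext (polyfunD hp hq) => y; rewrite rmorphD.
- by apply: polyfun_ext (polyfunM hp hq) => y; rewrite rmorphM.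
Qed.

Lemma stratum_act_map (t : torus F n) f : stratum_act Q t (pi f) = pi (chart_act Q t f).
Proof. by rewrite [LHS]stratum_actE quotient_actE. Qed.

Lemma chart_act_const (t : torus F n) c : chart_act Q t c%:MP = c%:MP.
Proof. exact: comp_mpolyC. Qed.

Lemma chart_actX (t : torus F n) v :
  chart_act Q t 'X_v = (\val t (col v) / \val t (row v))%:MP * 'X_v.
Proof. by rewrite mul_mpolyC /= comp_mpolyXU -tnth_nth tnth_mktuple. Qed.

Lemma row_lt3 v : (row v < 3)%N.
Proof. exact: (ltn_ord (\val (enum_val v)).1). Qed.

Lemma col_ge3 v : (col v < 3)%N = false.
Proof. by have := valP (enum_val v) => /andP[/leq_gtF ->]. Qed.

Lemma chart_eval_torus (t : torus F n) f :
  chart_eval (fun k => eta (if (k < 3)%N then (\val t k)^-1 else \val t k)) f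
  = stratum_act Q t (pi f).
Proof.
move: f; apply: (@mpoly_rmorph_eq _ _ _ _ [the {rmorphism _ -> _} of stratum_act Q t \o pi]).
  by move=> c; rewrite chart_evalC [RHS]stratum_act_map chart_act_const.
move=> v; rewrite chart_evalX row_lt3 col_ge3 [RHS]stratum_act_map chart_actX [RHS]rmorphM.
by rewrite -[pi _%:MP]/(eta _) [eta (_ / _)]rmorphM.
Qed.

Lemma chart_eval_torus_fun z (s : 'I_n -> F) : (forall k, s k != 0) ->
  (forall k, z k = eta (s k)) ->
  exists t : torus F n, forall f, chart_eval z f = stratum_act Q t (pi f).
Proof.
move=> s0 zs; pose t := [ffun k : 'I_n => if (k < 3)%N then (s k)^-1 else s k].
have t0 : [forall k, t k != 0].
  by apply/forallP => k; rewrite ffunE; case: ifP; rewrite ?invr_eq0.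
exists (exist _ t t0) => f; rewrite -chart_eval_torus; congr (chart_eval _ f).
by apply/funext => k /=; rewrite zs ffunE; case: ifP => k3; rewrite ?k3 ?invrK.
Qed.

(** Here [a] is the fraction [f / g], with denominators cleared so that both sides are polynomial in
    each coordinate of [z]. The identity holds at torus points over [F]; the coordinates are then
    freed one at a time by [polyfun_eq0]. *)
Lemma invariant_eval (a : S) f g : a \in @torus_invariant F 3 n Q ->
  pi f = pi g * a -> forall z, chart_eval z f = chart_eval z g * a.
Proof.
move=> /asboolP aT efg.
(* The first [j] coordinates are arbitrary and the others nonzero constants: [j = 0] is a torus
   point, [j = n] the claim. *)
suff h j z : (forall k : 'I_n, (j <= k)%N -> exists2 t : F, t != 0 & z k = eta t) ->
    chart_eval z f = chart_eval z g * a.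
  by move=> z; apply: (h n) => k; rewrite leqNgt ltn_ord.
elim: j z => [|j IH] z hz.
  have /choice[s hs] k : exists s, s != 0 /\ z k = eta s.
    by have [//|s s0 ->] := hz k; exists s.
  have [k|k|t tE] := @chart_eval_torus_fun z s; [exact: (hs k).1|exact: (hs k).2|].
  by rewrite !tE efg rmorphM aT.
have [nj|jn] := leqP n j.
  by apply: IH => k; rewrite leqNgt (leq_trans (ltn_ord k) nj).
pose k := Ordinal jn.
pose phi y := chart_eval (set_coord z k y) f - chart_eval (set_coord z k y) g * a.
have pphi : polyfun phi.
  have := polyfunD (chart_eval_polyfun z k f)
    (polyfunM (polyfunZ (-1) (chart_eval_polyfun z k g)) (polyfun_cst a)).
  by apply: polyfun_ext => y; rewrite mulN1r mulNr.
have phi0 := polyfun_eq0 (eta := eta) pphi _ (z k).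
have zk : set_coord z k (z k) = z.
  by apply/funext => i; rewrite /set_coord; case: eqP => [->|].
apply/eqP; rewrite -subr_eq0 -{1 2}zk; apply/eqP/phi0 => t t0.
rewrite /phi IH ?subrr // => i ji; rewrite /set_coord; case: eqP => [_|ik]; first by exists t.
apply: hz; rewrite ltn_neqAle ji andbT; apply/eqP => e; apply: ik.
exact: val_inj.
Qed.

End TorusInvariants.

Lemma inverse_uniq (B : comPzRingType) (x y y' : B) : x * y = 1 -> x * y' = 1 -> y = y'.
Proof. by move=> xy xy'; rewrite -[y]mulr1 -xy' mulrCA mulrA xy mul1r. Qed.

Section Weights.
Variables (k : fieldType) (B : comPzRingType).
Variables (eta : {rmorphism k -> B}) (f : {rmorphism B -> B}).

Lemma weight_mul x y c d :
  f x = eta c * x -> f y = eta d * y -> f (x * y) = eta (c * d) * (x * y).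
Proof. by move=> fx fy; rewrite [f _]rmorphM [eta _]rmorphM fx fy mulrACA. Qed.

Lemma weight_inv x y c :
  c != 0 -> x * y = 1 -> f x = eta c * x -> f y = eta c^-1 * y.
Proof.
move=> c0 xy fx; apply: (@inverse_uniq _ (f x)); first by rewrite -rmorphM xy rmorph1.
by rewrite fx mulrACA -rmorphM divff // rmorph1 mul1r.
Qed.

End Weights.

(** * Normalization by a projective frame *)

Section NormalForm.
Variables (F : numFieldType) (n : nat) (Q : matroid 3 n).
Local Notation S := (stratum_ring F Q).
Local Notation A := (realization_ring F Q).
Local Notation U := (@chart_entry F n Q).
Local Notation eta := (stratum_const F Q).
Local Notation pi := (stratum_map F Q).
Local Notation o := (row_index Q).

Lemma chart_entry_unit i a b (k : 'I_n) : (3 <= k)%N -> uniq [:: i; a; b] ->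
  [set k; o a; o b] \in bases Q -> exists y, U i k * y = 1.
Proof.
move=> k3 u kQ.
have ok j : (k == o j) = false.
  by apply/negP => /eqP e; have := ltn_ord j; rewrite -[val j]/(val (o j)) -e ltnNge k3.
have oo j j' : (o j == o j') = (j == j') by rewrite -val_eqE.
have Uo j c : U j (o c) = (c == j)%:R.
  by rewrite -val_eqE; apply: chart_entry_initial; apply: (ltn_ord c).
have ab : a != b by move: u; rewrite /= !inE andbT => /andP[].
have [|y hy] := @chart_entry_basis F n Q k (o a) (o b) _ kQ; first by rewrite /= !inE !ok oo ab.
suff [s hs] : exists s : bool, det3 (U^~ k) (U^~ (o a)) (U^~ (o b)) = (-1) ^+ s * U i k.
  by exists ((-1) ^+ s * y); rewrite -[RHS]hy hs; ring.
have Ui j h : U (@Ordinal 3 j h) k = U (inord j) k.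
  by congr (U _ k); apply: val_inj; rewrite /= inordK.
rewrite /det3 !Uo; move: u; clear ab kQ hy y oo.
case: i => [[|[|[|//]]] hi]; case: a => [[|[|[|//]]] ha]; case: b => [[|[|[|//]]] hb] //= _;
  rewrite -?val_eqE /= !Ui;
  first [by exists true; ring | by exists false; ring].
Qed.

Variables (k3 : 'I_n) (r : 'I_n -> 'I_3).
Hypothesis r_row : forall i, r (o i) = i.
Hypothesis U_ref : forall k, exists y, U (r k) k * y = 1.
Hypothesis U_frame : forall i, exists y, U i k3 * y = 1.

Lemma chart_entry_row i (k : 'I_n) : (k < 3)%N -> U i k = (k == o i)%:R.
Proof. by move=> kl; rewrite chart_entry_initial // -val_eqE. Qed.

(** Rescaling rows and columns turns column [k3] into ones and puts a one in row [r k] of each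
    column [k]. The normalized entries are invariant. They generate all invariants, inverses
    allowed, because the map from [S] to [A] sending [U] to [Y] is a substitution as in
    [invariant_eval] and so fixes every invariant. *)
Lemma normal_form : exists Y : 'I_3 -> 'I_n -> A,
  [/\ forall i (k : 'I_n), (k < 3)%N -> Y i k = (k == i :> nat)%:R,
      (forall i, Y i k3 = 1) /\ (forall k, Y (r k) k = 1),
      forall a b c : 'I_n, uniq [:: a; b; c] ->
        [set a; b; c] \notin bases Q -> det3 (Y^~ a) (Y^~ b) (Y^~ c) = 0,
      forall a b c : 'I_n, uniq [:: a; b; c] ->
        [set a; b; c] \in bases Q -> exists y, det3 (Y^~ a) (Y^~ b) (Y^~ c) * y = 1 &
      (forall i k, \val (Y i k) * (U (r k) k * U i k3) = U (r k) k3 * U i k)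
      /\ forall P : A -> Prop, (forall c, P (realization_const Q c)) ->
        (forall i k, P (Y i k)) -> (forall x y, P x -> P y -> P (x + y)) ->
        (forall x y, P x -> P y -> P (x * y)) -> (forall x y, x * y = 1 -> P x -> P y) ->
        forall x, P x].
Proof.
have /choice[ui hui] := U_ref.
have /choice[u3 hu3] := U_frame.
(* The torus scales [e k] by [t k3 / t k] and its inverse [e' k] by the reciprocal, which cancels
   the weight of [U i k] in [Yv]. *)
pose e k := U (r k) k3 * ui k.
pose e' k := u3 (r k) * U (r k) k.
have ee k : e k * e' k = 1.
  rewrite /e /e' -[RHS](mulr1 1) -{1}(hu3 (r k)) -(hui k); ring.
have Ur i : U i (o i) = 1.
  by rewrite chart_entry_row ?eqxx //; apply: (ltn_ord i).
have e'o i : e' (o i) = u3 i by rewrite /e' r_row Ur mulr1.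
pose Yv i k := e k * e' (o i) * U i k.
have actU (t : torus F n) i k :
    stratum_act Q t (U i k) = eta (\val t k / \val t (o i)) * U i k.
  rewrite stratum_actE quotient_actE chart_act_matrix -mul_mpolyC.
  exact: (rmorphM pi).
have t0 (t : torus F n) k : \val t k != 0 by apply: torus_neq0.
have act_e (t : torus F n) k : stratum_act Q t (e k) = eta (\val t k3 / \val t k) * e k.
  have := weight_mul (actU t (r k) k3)
    (weight_inv (mulf_neq0 (t0 t k) (invr_neq0 (t0 t (o (r k))))) (hui k) (actU t _ _)).
  by rewrite (_ : _ / _ * _ = \val t k3 / \val t k) //; field; rewrite !t0.
have act_e' (t : torus F n) k : stratum_act Q t (e' k) = eta (\val t k / \val t k3) * e' k.
  have := weight_inv (mulf_neq0 (t0 t k3) (invr_neq0 (t0 t k))) (ee k) (act_e t k).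
  by rewrite invf_div.
have YvT i k : Yv i k \in @torus_invariant F 3 n Q.
  apply/asboolP => t.
  have := weight_mul (weight_mul (act_e t k) (act_e' t (o i))) (actU t i k).
  rewrite (_ : _ / _ * (_ / _) * (_ / _) = 1 :> F); last by field; rewrite !t0.
  by move=> h; rewrite [LHS]h (rmorph1 eta) mul1r.
pose Y i k : A := exist (fun s => is_true (s \in @torus_invariant F 3 n Q)) _ (YvT i k).
have YE i k : \val (Y i k) = Yv i k by [].
have YI i (k : 'I_n) : (k < 3)%N -> Y i k = (k == i :> nat)%:R.
  move=> kl; apply: val_inj; rewrite YE /Yv rmorph_nat.
  rewrite chart_entry_initial //; case: eqP => [ki|_]; last by rewrite mulr0.
  by rewrite mulr1 (_ : k = o i) ?ee //; apply: val_inj.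
have valY a b c : \val (det3 (Y^~ a) (Y^~ b) (Y^~ c))
    = e a * e b * e c * (e' (o r0) * e' (o r1) * e' (o r2)) * det3 (U^~ a) (U^~ b) (U^~ c).
  rewrite rmorph_det3; apply: (@det3_scale _ (e a) (e b) (e c) (fun i => e' (o i))) => i /=;
    by rewrite /Yv mulrA.
(* An inverse in [S] of an invariant is itself invariant, since inverses are unique. *)
have valU (x : A) (y : S) : \val x * y = 1 -> exists y', x * y' = 1.
  move=> xy; suff yT : y \in @torus_invariant F 3 n Q.
    exists (exist (fun s => is_true (s \in @torus_invariant F 3 n Q)) _ yT).
    by apply: val_inj; rewrite rmorphM rmorph1.
  apply/asboolP => t; have /asboolP xT := valP x.
  apply: (@inverse_uniq _ (\val x)) => //.
  by rewrite -[X in X * _](xT t) -rmorphM xy rmorph1.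
have Y0 (a b c : 'I_n) : uniq [:: a; b; c] ->
    [set a; b; c] \notin bases Q -> det3 (Y^~ a) (Y^~ b) (Y^~ c) = 0.
  by move=> u ab; apply: val_inj; rewrite valY chart_entry_nonbasis // mulr0 rmorph0.
have YU (a b c : 'I_n) : uniq [:: a; b; c] ->
    [set a; b; c] \in bases Q -> exists y, det3 (Y^~ a) (Y^~ b) (Y^~ c) * y = 1.
  move=> u ab; have [y hy] := chart_entry_basis F u ab.
  apply: (valU _ (e' a * e' b * e' c * (e (o r0) * e (o r1) * e (o r2)) * y)).
  rewrite valY; set D := det3 _ _ _ in hy *.
  transitivity ((e a * e' a) * (e b * e' b) * (e c * e' c) * (e (o r0) * e' (o r0))
    * (e (o r1) * e' (o r1)) * (e (o r2) * e' (o r2)) * (D * y)); first by ring.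
  by rewrite !ee hy !mulr1.
exists Y; split=> //.
  split=> [i|k]; apply: val_inj; rewrite YE /Yv rmorph1 e'o /e.
    by rewrite hui mul1r mulrC hu3.
  by rewrite -[RHS](mulr1 1) -{1}(hui k) -(hu3 (r k)); ring.
split=> [i k|P Pc PY PD PM PV x].
  by rewrite YE /Yv e'o /e -[RHS]mulr1 -[X in _ = _ * X](mulr1 1) -{1}(hui k) -(hu3 i); ring.
have [sg [sgC sgU]] := stratum_lift (@realization_const F 3 n Q) YI Y0 YU.
(* With this [z], the substitution [z_i z_k x_ik] of [chart_eval] gives exactly [Yv]. *)
pose z (k : 'I_n) := if (k < 3)%N then e' k else e k.
have piX v : pi 'X_v = U (\val (enum_val v)).1 (\val (enum_val v)).2.
  rewrite -[RHS]/(pi _) mxE col_ge3; case: insubP => [w _ ew|].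
    by have -> : w = enum_val v; [apply: val_inj; rewrite ew; case: (\val _)|rewrite enum_valK].
  by rewrite -surjective_pairing (valP (enum_val v)).
have ev f : \val (sg (pi f)) = chart_eval z f.
  pose vsg := [the {rmorphism _ -> _} of (\val : A -> S) \o (sg \o pi)].
  move: f; apply: (@mpoly_rmorph_eq _ _ _ vsg) => [c|v].
    by rewrite chart_evalC -[vsg _]/(\val (sg (stratum_const F Q c))) sgC.
  rewrite chart_evalX -[vsg _]/(\val (sg (pi 'X_v))) piX sgU YE /Yv /z row_lt3 col_ge3.
  by [].
have PS f : P (sg (pi f)).
  move: f; apply: mpoly_gen => [c|v|p q hp hq|p q hp hq].
  - by rewrite -[pi _]/(stratum_const F Q c) sgC; apply: Pc.
  - by rewrite piX sgU; apply: PY.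
  - by rewrite [pi _]rmorphD [sg _]rmorphD; apply: PD.
  - by rewrite [pi _]rmorphM [sg _]rmorphM; apply: PM.
(* The invariant [x] is written as a fraction [f / g] of chart polynomials; it then equals the
   quotient of their normalized values. *)
have [[q s] ex] := loc_piP (\val x).
have [f ef] := quot_piP q; have [g eg] := quot_piP (den_val s).
have fgx : pi f = pi g * \val x.
  rewrite ex [pi f]/(loc_map _ (quot_pi _ f)) -ef [pi g]/(loc_map _ (quot_pi _ g)) -eg.
  rewrite loc_piM; apply: loc_pi_eqW.
  by change (q * (1 * den_val s) = den_val s * q * 1); ring.
have gu : pi g * loc_pi (1, s) = 1.
  rewrite [pi g]/(loc_map _ (quot_pi _ g)) -eg -(rmorph1 (@loc_map _ (@basis_minor F 3 n Q))).
  rewrite loc_piM; apply: loc_pi_eqW.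
  by change (den_val s * 1 * 1 = 1 * (1 * den_val s)); ring.
have sgfg : sg (pi f) = sg (pi g) * x.
  by apply: val_inj; rewrite [RHS]rmorphM -[RHS]/(\val (sg (pi g)) * \val x) !ev;
    exact: (invariant_eval (valP x) fgx z).
have sggu : sg (pi g) * sg (loc_pi (1, s)) = 1 by rewrite -rmorphM gu rmorph1.
have -> : x = sg (loc_pi (1, s)) * sg (pi f).
  by rewrite sgfg mulrA [sg (loc_pi _) * _]mulrC sggu mul1r.
by apply: PM; [apply: PV sggu _|].
Qed.

End NormalForm.

(** * Matroids of matrices *)

Section ColumnMatroid.
Variables (F : fieldType) (d n : nat) (V : 'M[F]_(d, n)).
Implicit Types (l b : {set 'I_n}).

Definition column_bases : {set {set 'I_n}} :=
  [set l : {set 'I_n} | (#|l| == d) && (plucker V l != 0)].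

Definition column_span (l : {set 'I_n}) : 'M[F]_d := (\sum_(k in l) <<row k V^T>>)%MS.

Lemma column_span_sub k (l : {set 'I_n}) : k \in l -> (row k V^T <= column_span l)%MS.
Proof.
by move=> kl; apply: (sumsmx_sup k) => //; rewrite genmxE.
Qed.

Lemma rank_column_span (l : {set 'I_n}) : (\rank (column_span l) <= #|l|)%N.
Proof.
rewrite -sum1_card.
apply: (big_ind2 (fun (A : 'M[F]_d) m => (\rank A <= m)%N)) => [|A a B b hA hB|k _].
- by rewrite mxrank0.
- exact: leq_trans (mxrank_adds_leqif A B).1 (leq_add hA hB).
- by rewrite mxrank_gen rank_leq_row.
Qed.

Lemma column_basesE (l : {set 'I_n}) : #|l| = d ->
  (l \in column_bases) = row_full (column_span l).
Proof.
move=> ld; rewrite inE ld eqxx /= /plucker.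
pose c (j : 'I_d) : 'I_n := enum_val (cast_ord (esym ld) j).
set M := (X in \det X); have ME : M = \matrix_(i, j) V i (c j).
  apply/matrixP => i j; rewrite !mxE (nth_map (c j)); last by rewrite -cardE ld.
  by congr (V _ _); symmetry; exact: enum_val_nth.
rewrite -det_tr -unitfE -unitmxE -row_full_unit -!sub1mx.
apply/idP/idP => h; apply: submx_trans h _.
  apply/row_subP => j; rewrite (_ : row j _ = row (c j) V^T).
    by apply: column_span_sub; apply: enum_valP.
  by apply/rowP => i; rewrite ME !mxE.
apply/sumsmx_subP => k kl; rewrite genmxE.
have -> : row k V^T = row (cast_ord ld (enum_rank_in kl k)) M^T.
  apply/rowP => i; rewrite ME !mxE /c cast_ordK enum_rankK_in //.
exact: row_sub.
Qed.

(** The columns of [b1] without [x] span a space [W] of dimension less than [d], so some column [y]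
    of [b2] lies outside it, and adding [y] to [W] gives the full space. *)
Lemma column_bases_exchange b1 b2 x :
  b1 \in column_bases -> b2 \in column_bases -> x \in b1 :\: b2 ->
  exists2 y, y \in b2 :\: b1 & y |: (b1 :\ x) \in column_bases.
Proof.
move=> B1 B2; rewrite inE => /andP[xb2 xb1].
have d1 : #|b1| = d by move: B1; rewrite inE => /andP[/eqP].
have d2 : #|b2| = d by move: B2; rewrite inE => /andP[/eqP].
have dx : #|b1 :\ x|.+1 = d by rewrite -d1 [RHS](cardsD1 x) xb1.
move: B1 B2; rewrite !column_basesE // => B1 B2.
set W := column_span (b1 :\ x).
have [y yb2 yW] : exists2 y, y \in b2 & ~~ (row y V^T <= W)%MS.
  apply/exists_inP; rewrite -[X in is_true X]negbK negb_exists_in; apply/forall_inP => h.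
  have : (column_span b2 <= W)%MS.
    by apply/sumsmx_subP => k kb2; rewrite genmxE; apply/negbNE/h.
  move=> /mxrankS; move: B2; rewrite /row_full => /eqP -> dW.
  by have := leq_trans dW (rank_column_span _); rewrite -ltnS dx ltnn.
have yb1 : y \notin b1 :\ x by apply: contra yW => /column_span_sub.
have yx : y != x by apply: contraNneq xb2 => <-.
exists y; first by move: yb1; rewrite !inE yx yb2 /= andbT.
rewrite column_basesE; last by rewrite cardsU1 yb1.
have spanU z : (column_span (z |: (b1 :\ x)) :=: row z V^T + W)%MS.
  apply/eqmxP/andP; split.
    apply/sumsmx_subP => k; rewrite genmxE !inE => /orP[/eqP ->|kb]; first exact: addsmxSl.
    apply: submx_trans (addsmxSr _ _); apply: column_span_sub; by rewrite !inE.
  rewrite addsmx_sub column_span_sub ?setU11 //=.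
  by apply/sumsmx_subP => k kb; rewrite genmxE column_span_sub // setU1r.
have {}B1 : \rank (row x V^T + W)%MS = d by rewrite -spanU setD1K //; apply/eqP.
rewrite /row_full spanU eqn_leq rank_leq_col /=.
have : (d <= (\rank W).+1)%N.
  rewrite -{1}B1; apply: leq_trans (mxrank_adds_leqif _ _).1 _.
  by rewrite -(add1n (\rank W)) leq_add2r rank_leq_row.
have sW : (W <= row y V^T + W)%MS := addsmxSr _ _.
move=> /leq_trans; apply; rewrite (ltn_leqif (mxrank_leqif_sup sW)).
by apply: contra yW; rewrite addsmx_sub => /andP[].
Qed.

Lemma column_bases_matroid : column_bases != set0 -> matroid_bases [set: 'I_n] column_bases.
Proof. by move=> b0; split=> // *; exact: column_bases_exchange. Qed.

Lemma column_bases_rank b : b \in column_bases -> #|b| = d.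
Proof. by rewrite inE => /andP[/eqP]. Qed.

Definition column_matroid (b0 : column_bases != set0) : matroid d n :=
  Matroid (column_bases_matroid b0) column_bases_rank.

Lemma column_matroid_realizable (b0 : column_bases != set0) :
  realizable F (column_matroid b0).
Proof.
exists V => [|l ld]; last by rewrite inE ld eqxx.
have [b bB] := set0Pn _ b0.
have := bB; rewrite column_basesE ?(column_bases_rank bB) // => /eqP full.
apply/eqP; rewrite eqn_leq rank_leq_row /=.
apply: leq_trans (eq_leq (esym full)) _; rewrite -(mxrank_tr V) mxrankS //.
by apply/sumsmx_subP => k _; rewrite genmxE row_sub.
Qed.

End ColumnMatroid.

(** * A criterion against direct sums *)

Section Connectedness.
Variables (d n : nat) (Q : matroid d n).

(* In a direct sum all bases meet a summand in the same number of elements. *)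
Lemma direct_sum_exchange (E : {set 'I_n}) B1 B2 (b : {set 'I_n}) x y :
  matroid_bases E B1 -> matroid_bases (~: E) B2 ->
  bases Q = [set b1 :|: b2 | b1 in B1, b2 in B2] ->
  b \in bases Q -> x \in b -> y \notin b -> y |: (b :\ x) \in bases Q ->
  (x \in E) = (y \in E).
Proof.
move=> [_ s1 _] [_ s2 _] QE bQ xb yb b'Q.
have cardE b1 b2 : b1 \in B1 -> b2 \in B2 -> (#|b1| + #|b2|)%N = d.
  move=> h1 h2; have <- : #|b1 :|: b2| = d by apply: (@bases_rank _ _ Q); rewrite QE imset2_f.
  rewrite cardsU (_ : b1 :&: b2 = set0) ?cards0 ?subn0 //.
  apply/eqP; rewrite -subset0 -(setICr E); apply: setISS; [exact: s1|exact: s2].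
have capE b1 b2 : b1 \in B1 -> b2 \in B2 -> (b1 :|: b2) :&: E = b1.
  move=> /s1 h1 /s2 h2; rewrite setIUl (setIidPl h1) (_ : b2 :&: E = set0) ?setU0 //.
  by apply/eqP; rewrite setI_eq0 disjoints_subset.
move: bQ b'Q; rewrite QE => /imset2P[b1 b2 h1 h2 eb] /imset2P[b1' b2' h1' h2' eb'].
have e : #|b1| = #|b1'|.
  by apply/eqP; rewrite -(eqn_add2r #|b2|) (cardE _ _ h1 h2) (cardE _ _ h1' h2).
move: e; rewrite -{1}(capE _ _ h1 h2) -(capE _ _ h1' h2') -eb -eb' => e.
have [xE|xE] := boolP (x \in E); have [yE|yE] := boolP (y \in E) => //; exfalso.
  move: e; rewrite (cardsD1 x) inE xb xE /=.
  rewrite (_ : (b :&: E) :\ x = (y |: b :\ x) :&: E);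
    first by move/eqP; rewrite -[X in _ == X]add0n eqn_add2r.
  by apply/setP => z; rewrite !inE; case: (eqVneq z y) => [->|_]; rewrite ?(negPf yE) ?andbF ?andbA.
move: e; rewrite [RHS](cardsD1 y) !inE eqxx yE /=.
rewrite (_ : _ :\ y = b :&: E); first by move/eqP; rewrite -[X in X == _]add0n eqn_add2r.
apply/setP => z; rewrite !inE; case: (eqVneq z y) => [->|_]; first by rewrite (negPf yb).
by case: (eqVneq z x) => [->|_] //=; rewrite (negPf xE) !andbF.
Qed.

End Connectedness.

(** * The configuration *)

Section Det3Alternating.
Variable R : comPzRingType.
Implicit Types p q r : 'I_3 -> R.

Lemma det3_swap12 p q r : det3 q p r = - det3 p q r. Proof. by rewrite /det3; ring. Qed.
Lemma det3_swap23 p q r : det3 p r q = - det3 p q r. Proof. by rewrite /det3; ring. Qed.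
Lemma det3_eq12 p r : det3 p p r = 0. Proof. by rewrite /det3; ring. Qed.
Lemma det3_eq23 p r : det3 r p p = 0. Proof. by rewrite /det3; ring. Qed.
Lemma det3_eq13 p r : det3 p r p = 0. Proof. by rewrite /det3; ring. Qed.

End Det3Alternating.

Section Configuration.
Variable R : comPzRingType.
Implicit Types u v : R.

(* Homogeneous coordinates of the twelve points. Modulo [u * v], setting one of *)
(* the parameters to [0] gives a family of realizations over the other branch;   *)
(* the polynomials glue the two families.                                        *)
Definition configuration u v : seq (seq R) :=
  let d := 3 + 3 * u + u ^+ 2 in
  let e := 2 + 2 * u + u ^+ 2 - v in
  let w := 6 + 9 * u + 5 * u ^+ 2 + u ^+ 3 - 3 * v in
  let h := 5 + 8 * u + 5 * u ^+ 2 + u ^+ 3 - 5 * v - v ^+ 2 in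
  [:: [:: 1; 0; 0]; [:: 0; 1; 0]; [:: 0; 0; 1]; [:: 1; 1; 1]; [:: 1; 1; 0];
      [:: 2 + u; 1; 0]; [:: 1 - 2 * v; e; d];
      [:: 4 + 6 * u + 4 * u ^+ 2 + u ^+ 3 - 2 * v; e; d]; [:: 2 + u - v; d; d];
      [:: w; h; w]; [:: 0; h; w];
      [:: 4 + 4 * u + u ^+ 2 - 4 * v + v ^+ 2; 3 + 3 * u + u ^+ 2 - 6 * v; w]].

Definition config_pt u v (j : nat) (i : 'I_3) : R := nth 0 (nth [::] (configuration u v) j) i.

Definition config_det u v a b c : R :=
  det3 (config_pt u v a) (config_pt u v b) (config_pt u v c).

End Configuration.

Lemma rmorph_config (R S : comPzRingType) (f : {rmorphism R -> S}) u v j i :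
  f (config_pt u v j i) = config_pt (f u) (f v) j i.
Proof.
rewrite /config_pt.
have -> : configuration (f u) (f v) = [seq [seq f x | x <- s] | s <- configuration u v].
  by rewrite /configuration /= !(rmorphD, rmorphN, rmorphM, rmorphXn, rmorph0, rmorph1, rmorph_nat).
have [jl|jl] := ltnP j (size (configuration u v)); last first.
  by rewrite !(nth_default [::]) ?size_map // !nth_nil rmorph0.
rewrite (nth_map [::]) //; set s := nth [::] _ _.
have [il|il] := ltnP i (size s); first by rewrite (nth_map 0).
by rewrite !nth_default ?size_map // rmorph0.
Qed.

Lemma rmorph_config_det (R S : comPzRingType) (f : {rmorphism R -> S}) u v a b c :
  f (config_det u v a b c) = config_det (f u) (f v) a b c.
Proof. by rewrite /config_det rmorph_det3 /det3 /= !rmorph_config. Qed.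

(** The configuration at the node [u = v = 0], over the integers so that its minors can be
    computed. *)
Definition special_det := @config_det int 0 0.

(** The collinear triples at the node, in increasing order. The points 0, 1, 4, 5 lie on one line
    and account for four of them. *)
Definition special_lines : seq (nat * nat * nat) :=
  [:: (0, 1, 4); (0, 1, 5); (0, 3, 8); (0, 4, 5); (0, 6, 7); (0, 9, 10); (1, 2, 10);
      (1, 3, 9); (1, 4, 5); (1, 8, 11); (2, 3, 4); (2, 5, 7); (3, 5, 6); (4, 6, 8);
      (4, 9, 11); (6, 10, 11); (7, 8, 9)]%N.

Lemma config_det_lines (R : comPzRingType) (u v : R) t : u * v = 0 ->
  t \in special_lines -> config_det u v t.1.1 t.1.2 t.2 = 0.
Proof.
move=> uv0.
(* Every determinant is an explicit multiple of [u * v] as a polynomial. For twelve triples the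
   cofactor is [0]; the five others need the cofactors given below. *)
have uvE q x : x = q * (u * v) -> x = 0 by move->; rewrite uv0 mulr0.
have H a b c q : config_det u v a b c = q * (u * v) ->
  config_det u v (a, b, c).1.1 (a, b, c).1.2 (a, b, c).2 = 0 by move/uvE.
rewrite !inE; do ![case/orP]; move/eqP => ->.
- by apply: (H _ _ _ 0); rewrite /config_det /det3 /config_pt /=; ring.
all: try by apply: (H _ _ _ 0); rewrite /config_det /det3 /config_pt /=; ring.
- by apply: (H _ _ _ (u ^+ 2 + u * v + u + 3 * v)); rewrite /config_det /det3 /config_pt /=; ring.
- by apply: (H _ _ _ (-1)); rewrite /config_det /det3 /config_pt /=; ring.
- by apply: (H _ _ _ (-1)); rewrite /config_det /det3 /config_pt /=; ring.
- apply: (H _ _ _ (- 54 + 30 * v + 6 * v ^+ 2 + 3 * v ^+ 3 - 134 * u + 33 * u * v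
    + 3 * u * v ^+ 2 + u * v ^+ 3 - 136 * u ^+ 2 + 9 * u ^+ 2 * v + u ^+ 2 * v ^+ 2
    - 71 * u ^+ 3 - 19 * u ^+ 4 - 2 * u ^+ 5)).
  by rewrite /config_det /det3 /config_pt /=; ring.
apply: (H _ _ _ (9 + 15 * v - 3 * v ^+ 2 + 20 * u + 25 * u * v - u * v ^+ 2 + 16 * u ^+ 2
  + 19 * u ^+ 2 * v + 6 * u ^+ 3 + 7 * u ^+ 3 * v + u ^+ 4 + u ^+ 4 * v)).
by rewrite /config_det /det3 /config_pt /=; ring.
Qed.

(** A finite computation showing that the list of lines is complete up to the order of the
    points. *)
Lemma special_det_lines a b c : (a < 12)%N -> (b < 12)%N -> (c < 12)%N ->
  special_det a b c = 0 -> [|| a == b, b == c, a == c |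
    has (mem special_lines) [:: (a, b, c); (a, c, b); (b, a, c); (b, c, a); (c, a, b); (c, b, a)]].
Proof.
move=> a12 b12 c12 /eqP d0.
have /allP ha : all (fun a => all (fun b => all (fun c => (special_det a b c == 0) ==>
  [|| a == b, b == c, a == c | has (mem special_lines)
    [:: (a, b, c); (a, c, b); (b, a, c); (b, c, a); (c, a, b); (c, b, a)]])
  (iota 0 12)) (iota 0 12)) (iota 0 12) by vm_compute.
have mem12 x : (x < 12)%N -> x \in iota 0 12 by rewrite mem_iota.
have /allP hb := ha a (mem12 a a12); have /allP hc := hb b (mem12 b b12).
exact: implyP (hc c (mem12 c c12)) d0.
Qed.

(** The dependencies of the special configuration persist on both branches of the node; other orders
    of a listed triple only change the sign. *)
Lemma config_det_eq0 (R : comPzRingType) (u v : R) a b c : u * v = 0 ->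
  (a < 12)%N -> (b < 12)%N -> (c < 12)%N -> special_det a b c = 0 ->
  config_det u v a b c = 0.
Proof.
move=> uv0 a12 b12 c12 /(special_det_lines a12 b12 c12).
case/or4P => [/eqP ->|/eqP ->|/eqP ->|].
- exact: det3_eq12.
- exact: det3_eq23.
- exact: det3_eq13.
have s12 x y z : config_det u v x y z = - config_det u v y x z := det3_swap12 _ _ _.
have s23 x y z : config_det u v x y z = - config_det u v x z y := det3_swap23 _ _ _.
have L x y z : (x, y, z) \in special_lines -> config_det u v x y z = 0.
  exact: (@config_det_lines _ _ _ (x, y, z) uv0).
rewrite /= orbF => /or4P[||| /or3P[]] h.
- exact: L h.
- by rewrite s23 (L _ _ _ h) oppr0.
- by rewrite s12 (L _ _ _ h) oppr0.
- by rewrite s12 s23 (L _ _ _ h) !oppr0.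
- by rewrite s23 s12 (L _ _ _ h) !oppr0.
- by rewrite s12 s23 s12 (L _ _ _ h) !oppr0.
Qed.

(** * Solving the collinearities of a normalized realization *)

Section SolveConfiguration.
Variables (R : comPzRingType) (y : nat -> 'I_3 -> R).

(** The general normalized solution of all the collinearities except [(7, 8, 9)] and [(6, 10, 11)];
    [m], [r] and [h] are free coordinates of the points 5, 6 and 9. *)
Definition normal_pt (m r h : R) (j : nat) (i : 'I_3) : R :=
  nth 0 (nth [::] [:: [:: 1; 0; 0]; [:: 0; 1; 0]; [:: 0; 0; 1]; [:: 1; 1; 1]; [:: 1; 1; 0];
    [:: m; 1; 0]; [:: 1 + m * r; 1 + r; 1]; [:: m + m * r; 1 + r; 1];
    [:: 1 + m * r - r; 1; 1]; [:: 1; h; 1]; [:: 0; h; 1];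
    [:: 1 + m * r - r; h + m * r - r; 1]] j) i.

Hypothesis y_initial : forall j i, (j < 3)%N -> y j i = (j == i)%:R.
Hypothesis y3 : forall i, y 3 i = 1.
Hypothesis y4 : y 4 r0 = 1.
Hypothesis y5 : y 5 r1 = 1.
Hypothesis y_affine : forall j, (6 <= j < 12)%N -> y j r2 = 1.
Hypothesis y_line : forall t, t \in special_lines -> det3 (y t.1.1) (y t.1.2) (y t.2) = 0.

Let line_eq (a b c : nat) (s x z : R) : (a, b, c) \in special_lines ->
  x - z = s * det3 (y a) (y b) (y c) -> x = z.
Proof.
move=> abc e; apply/eqP; rewrite -subr_eq0 e.
by rewrite (y_line abc) mulr0.
Qed.

(** The two invertible minors are [- r] and [1 - r - m]. The first allows cancelling [r] in the
    final equation, the second allows solving for [h]. *)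
Lemma solve_configuration (w w' : R) :
  det3 (y 0%N) (y 3) (y 6) * w = 1 -> det3 (y 1%N) (y 7) (y 8) * w' = 1 ->
  exists m r h, [/\ forall j i, (j < 12)%N -> y j i = normal_pt m r h j i,
    (1 + r - h) * (1 - r - m) = r * (1 - m - m * r),
    exists w, (1 - r - m) * w = 1 &
    (m - 2) * ((1 - m) - r * (m ^+ 2 - m + 1)) = 0].
Proof.
move=> hw hw'.
have e0 : y 0%N r0 = 1 by rewrite y_initial.
have e1 : y 0%N r1 = 0 by rewrite y_initial.
have e2 : y 0%N r2 = 0 by rewrite y_initial.
have e3 : y 1%N r0 = 0 by rewrite y_initial.
have e4 : y 1%N r1 = 1 by rewrite y_initial.
have e5 : y 1%N r2 = 0 by rewrite y_initial.
have e6 : y 2%N r0 = 0 by rewrite y_initial.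
have e7 : y 2%N r1 = 0 by rewrite y_initial.
have e8 : y 2%N r2 = 1 by rewrite y_initial.
have e9 := (e0, e1, e2, e3, e4, e5, e6, e7, e8, y3, y4, y5).
have a6 : y 6 r2 = 1 by rewrite y_affine.
have a7 : y 7 r2 = 1 by rewrite y_affine.
have a8 : y 8 r2 = 1 by rewrite y_affine.
have a9 : y 9 r2 = 1 by rewrite y_affine.
have a10 : y 10 r2 = 1 by rewrite y_affine.
have a11 : y 11 r2 = 1 by rewrite y_affine.
have a := (a6, a7, a8, a9, a10, a11).
(* From here to [y111] each collinearity fixes one coordinate; the scalar given to [line_eq] is the
   sign of that coordinate in the determinant. *)
have y42 : y 4 r2 = 0.
  by apply: (@line_eq 0 1 4 1) => //; rewrite /det3 !e9; ring.
have y41 : y 4 r1 = 1.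
  by apply: (@line_eq 2 3 4 1) => //; rewrite /det3 !e9; ring.
have y52 : y 5 r2 = 0.
  by apply: (@line_eq 0 1 5 1) => //; rewrite /det3 !e9; ring.
pose m := y 5 r0; pose r := y 6 r1 - 1; pose h := y 9 r1.
have y61 : y 6 r1 = 1 + r by rewrite /r addrC subrK.
have y60 : y 6 r0 = 1 + m * r.
  by apply: (@line_eq 3 5 6 (-1)) => //; rewrite /det3 !e9 !a y52 y61 -/m; ring.
have y71 : y 7 r1 = 1 + r.
  by apply: (@line_eq 0 6 7 (-1)) => //; rewrite /det3 !e9 !a y61; ring.
have y70 : y 7 r0 = m + m * r.
  by apply: (@line_eq 2 5 7 (-1)) => //; rewrite /det3 !e9 !a y71 -/m; ring.
have y81 : y 8 r1 = 1.
  by apply: (@line_eq 0 3 8 (-1)) => //; rewrite /det3 !e9 !a; ring.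
have y80 : y 8 r0 = 1 + m * r - r.
  by apply: (@line_eq 4 6 8 1) => //; rewrite /det3 !e9 !a y41 y42 y60 y61 y81; ring.
have y90 : y 9 r0 = 1.
  by apply: (@line_eq 1 3 9 1) => //; rewrite /det3 !e9 !a; ring.
have y100 : y 10 r0 = 0.
  by apply: (@line_eq 1 2 10 1) => //; rewrite /det3 !e9 !a; ring.
have y101 : y 10 r1 = h.
  by apply: (@line_eq 0 9 10 (-1)) => //; rewrite /det3 !e9 !a -/h; ring.
have y110 : y 11 r0 = 1 + m * r - r.
  by apply: (@line_eq 1 8 11 1) => //; rewrite /det3 !e9 !a y80; ring.
have y111 : y 11 r1 = h + m * r - r.
  by apply: (@line_eq 4 9 11 (-1)) => //; rewrite /det3 !e9 !a y41 y42 y90 y110 -/h; ring.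
(* The lines [(7, 8, 9)] and [(6, 10, 11)] are the two remaining conditions on [m], [r] and [h]. *)
have c1 : (1 + r - h) * (1 - r - m) = r * (1 - m - m * r).
  apply: (@line_eq 7 8 9 (-1)) => //.
  by rewrite /det3 !a y70 y71 y80 y81 y90 -/h; ring.
have c2 : (1 + m * r - r) * (1 + r - h) = (m * r - r) * (1 + m * r).
  apply: (@line_eq 6 10 11 1) => //.
  by rewrite /det3 !a y60 y61 y100 y101 y110 y111; ring.
exists m, r, h; split=> //.
- move=> j i j12; rewrite /normal_pt.
  case: i => [[|[|[|//]]] hi]; rewrite /=.
  + rewrite (_ : Ordinal hi = r0); last exact: val_inj.
    by do 12![case: j j12 => [|j] j12 //=].
  + rewrite (_ : Ordinal hi = r1); last exact: val_inj.
    by do 12![case: j j12 => [|j] j12 //=].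
  + rewrite (_ : Ordinal hi = r2); last exact: val_inj.
    by do 12![case: j j12 => [|j] j12 //=].
- exists w'; rewrite -[RHS]hw'; congr (_ * _).
  by rewrite /det3 !e9 !a y70 y71 y80 y81; ring.
(* Elimination of [h]: [c2] times [1 - r - m] and [c1] times [1 + m * r - r] have the same left
   side. *)
have F0 : r * ((m - 2) * ((1 - m) - r * (m ^+ 2 - m + 1))) = 0.
  transitivity ((1 - r - m) * ((1 + m * r - r) * (1 + r - h))
    - (1 + m * r - r) * ((1 + r - h) * (1 - r - m))); last by ring.
  by rewrite c1 c2; ring.
have rw : r * - w = 1.
  by rewrite -[RHS]hw /det3 !e9 !a y61 y60; ring.
move: F0; move: ((m - 2) * _) => x F0.
by rewrite -[x]mul1r -rw mulrAC F0 mul0r.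
Qed.

End SolveConfiguration.

(** * The matroid *)

Lemma relabel1 d n (Q : matroid d n) : relabel 1%g Q = Q.
Proof.
have : bases (relabel 1%g Q) = bases Q.
  rewrite /= -[RHS]imset_id; apply: eq_imset => b.
  by rewrite -[RHS]imset_id; apply: eq_imset => k; rewrite perm1.
case: (relabel _ _) => B M E; case: Q => B' M' E' /= e; subst B'.
by congr Matroid; apply: Prop_irrelevance.
Qed.

(** With [node_unit], a polynomial in [u] and [v] is a unit of the node ring as soon as its value at
    the origin is nonzero. *)
Lemma node_of_const_term (k : fieldType) (p : {mpoly k[2]}) :
  node_ord 1 (node_of k p - node_const 0 (p.@[fun=> 0])).
Proof.
move: p; apply: mpoly_gen => [c|i|p q hp hq|p q hp hq].
- by rewrite mevalC subrr; apply: node_ord0.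
- rewrite mevalXU (_ : node_const 0 0 = 0); last exact: (rmorph0 (node_of k \o @mpolyC 2 k)).
  rewrite subr0; case: (ord2E i) => ->; [exact: node_u_ord1|exact: node_v_ord1].
- rewrite rmorphD mevalD.
  rewrite (_ : node_const 0 _ = node_const 0 p.@[fun=> 0] + node_const 0 q.@[fun=> 0]).
    by rewrite opprD addrACA; apply: node_ordD.
  exact: (rmorphD (node_of k \o @mpolyC 2 k)).
rewrite [node_of k _]rmorphM mevalM.
rewrite (_ : node_const 0 _ = node_const 0 p.@[fun=> 0] * node_const 0 q.@[fun=> 0]); last first.
  exact: (rmorphM (node_of k \o @mpolyC 2 k)).
move: (node_of k p) (node_of k q) (node_const 0 p.@[fun=> 0]) (node_const 0 q.@[fun=> 0])
  hp hq => a b a' b' hp hq.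
rewrite (_ : _ - _ = b * (a - a') + a' * (b - b')); last by ring.
exact: node_ordD (node_ordMl _ hp) (node_ordMl _ hq).
Qed.

Section NodalMatroid.
Variables (F : numFieldType) (n : nat) (n12 : (12 <= n)%N).

(* All elements from number 11 on are parallel. *)
Definition label (k : 'I_n) : nat := minn k 11.

Lemma label_lt k : (label k < 12)%N.
Proof. by rewrite /label ltnS geq_minr. Qed.

Definition elt (j : nat) : 'I_n := widen_ord n12 (inord j).

Lemma label_elt j : (j < 12)%N -> label (elt j) = j.
Proof. by move=> j12; rewrite /label /= inordK //; apply/minn_idPl. Qed.

Lemma elt_label (k : 'I_n) : (k < 12)%N -> elt (label k) = k.
Proof.
move=> k12; apply: val_inj; rewrite /= inordK ?label_lt // /label.
by apply/minn_idPl.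
Qed.

Definition nodal_matrix : 'M[F]_(3, n) :=
  \matrix_(i, k) (config_pt (0 : int) 0 (label k) i)%:~R.

(** The determinants are integers, and stay nonzero in [F] because the characteristic is zero. *)
Lemma nodal_basesE (a b c : 'I_n) : uniq [:: a; b; c] ->
  ([set a; b; c] \in column_bases nodal_matrix)
  = (special_det (label a) (label b) (label c) != 0).
Proof.
move=> u; rewrite inE; have -> : #|[set a; b; c]| == 3.
  by rewrite -[3]/(size [:: a; b; c]) -(card_uniqP u); apply/eqP/eq_card => x; rewrite !inE orbA.
have [s hs] := minor3 u; rewrite /plucker (hs _ (fun i k => nodal_matrix i k)).
rewrite mulf_eq0 signr_eq0 /=; congr (~~ _); rewrite -(intr_eq0 F).
congr (_ == _); rewrite /special_det /config_det.
by rewrite (rmorph_det3 (intmul 1)) /det3 !mxE.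
Qed.

Lemma elt_uniq a b c : (a < 12)%N -> (b < 12)%N -> (c < 12)%N ->
  uniq [:: a; b; c] -> uniq [:: elt a; elt b; elt c].
Proof.
move=> a12 b12 c12; move=> u; rewrite -[uniq _]/(uniq [seq elt j | j <- [:: a; b; c]]).
rewrite map_inj_in_uniq // => x y; rewrite !inE => hx hy e.
have lt12 z : [|| z == a, z == b | z == c] -> (z < 12)%N by case/or3P => /eqP ->.
by rewrite -(label_elt (lt12 x hx)) e label_elt ?lt12.
Qed.

Lemma nodal_bases_neq0 : column_bases nodal_matrix != set0.
Proof.
apply/set0Pn; exists [set elt 0; elt 1; elt 2].
by rewrite nodal_basesE ?elt_uniq // !label_elt.
Qed.

Definition nodal_matroid : matroid 3 n := column_matroid nodal_bases_neq0.
Local Notation Q := nodal_matroid.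
Local Notation o := (row_index Q).

Lemma nodal_matroidE (a b c : 'I_n) : uniq [:: a; b; c] ->
  ([set a; b; c] \in bases Q) = (special_det (label a) (label b) (label c) != 0).
Proof. exact: nodal_basesE. Qed.

Lemma row_elt (i : 'I_3) : o i = elt i.
Proof. by apply: val_inj; rewrite /= inordK // (ltn_trans (ltn_ord i)). Qed.

Lemma label_row (i : 'I_3) : label (o i) = i.
Proof. by rewrite row_elt label_elt // (ltn_trans (ltn_ord i)). Qed.

Lemma rows_initial (i a b : 'I_3) : uniq [:: i; a; b] ->
  [set o i; o a; o b] = initial_set 3 n.
Proof.
move=> u; apply/setP => x; rewrite !inE; apply/idP/idP => [|x3].
  by rewrite -orbA => /or3P[] /eqP ->; apply: (ltn_ord (_ : 'I_3)).
have -> : x = o (Ordinal x3) by apply: val_inj.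
rewrite -!val_eqE /=; move: u; rewrite /= !inE -!val_eqE /=.
move: (val x) (val i) (val a) (val b) x3 (ltn_ord i) (ltn_ord a) (ltn_ord b).
by do 4![case=> [|[|[|//]]]].
Qed.

Lemma row_new (i a b : 'I_3) (k : 'I_n) : (3 <= k)%N -> uniq [:: i; a; b] ->
  uniq [:: k; o a; o b].
Proof.
move=> k3; have ok j : (k == o j) = false.
  by apply/negP => /eqP e; have := ltn_ord j; rewrite -[val j]/(val (o j)) -e ltnNge k3.
by rewrite /= !inE !ok !andbT -!val_eqE /= => /andP[].
Qed.

Lemma initial_basis : initial_set 3 n \in bases Q.
Proof.
rewrite -(rows_initial (_ : uniq [:: r0; r1; r2])) // nodal_matroidE ?label_row //.
Qed.

(** The row in which each point is normalized to [1]. The points 4 and 5 have last coordinate zero;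
    row 1 for point 5 leaves its first coordinate as the parameter [m]. *)
Definition ref_row (k : 'I_n) : 'I_3 :=
  if label k \in [:: 0; 4] then r0 else if label k \in [:: 1; 5] then r1 else r2.

Lemma ref_row_row i : ref_row (o i) = i.
Proof.
rewrite /ref_row label_row; case: i => [[|[|[|//]]] hi] /=; exact: val_inj.
Qed.

Lemma ref_row_basis (k : 'I_n) : (3 <= k)%N ->
  exists a b, uniq [:: ref_row k; a; b] /\ [set k; o a; o b] \in bases Q.
Proof.
move=> k3; have l3 : (3 <= label k)%N by rewrite /label leq_min k3.
have E (i a b : 'I_3) : uniq [:: i; a; b] -> special_det (label k) a b != 0 ->
    uniq [:: i; a; b] /\ [set k; o a; o b] \in bases Q.
  by move=> u d; rewrite nodal_matroidE ?(row_new k3 u) // !label_row.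
rewrite /ref_row; move: (label_lt k) l3 E; case: (label k) => [|[|[|j]]] // j12 _ E.
have e012 : (uniq [:: r0; r1; r2]) * (uniq [:: r1; r0; r2]) * (uniq [:: r2; r0; r1]) by [].
do 9?[case: j j12 E => [|j] j12 E //];
  first [by exists r0, r1; apply: E | by exists r1, r2; apply: E | by exists r0, r2; apply: E].
Qed.

Lemma frame_basis i : exists a b, uniq [:: i; a; b] /\ [set elt 3; o a; o b] \in bases Q.
Proof.
have E (a b : 'I_3) : uniq [:: i; a; b] -> special_det 3 a b != 0 ->
    uniq [:: i; a; b] /\ [set elt 3; o a; o b] \in bases Q.
  move=> u d; rewrite nodal_matroidE ?label_elt ?label_row //.
  by apply: row_new u; rewrite /= inordK.
case: i E => [[|[|[|//]]] hi] E.
- by exists r1, r2; apply: E.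
- by exists r0, r2; apply: E.
- by exists r0, r1; apply: E.
Qed.

(** By [direct_sum_exchange] from the initial basis, element 3 lies on the same side as each of the
    first three elements, and every later element on the same side as the one of its reference
    row. *)
Lemma nodal_matroid_connected : connected_matroid Q.
Proof.
case=> E [B1 [B2 [E0 ET M1 M2 QE]]].
have exch (i a b : 'I_3) (k : 'I_n) : (3 <= k)%N -> uniq [:: i; a; b] ->
    [set k; o a; o b] \in bases Q -> (o i \in E) = (k \in E).
  move=> k3 u kQ; apply: (direct_sum_exchange M1 M2 QE initial_basis).
  - by rewrite inE; apply: (ltn_ord i).
  - by rewrite inE -leqNgt.
  suff -> : k |: (initial_set 3 n :\ o i) = [set k; o a; o b] by [].
  rewrite -(rows_initial u); apply/setP => x; rewrite !inE -!orbA; congr (_ || _).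
  case: (eqVneq x (o i)) => [->|_] //=.
  by move: u; rewrite /= !inE !andbT -!val_eqE /= => /andP[/norP[/negPf ia /negPf ib] _];
    rewrite ?ia ?ib.
have all3 k : (k \in E) = (elt 3 \in E).
  have e3 : (3 <= elt 3)%N by rewrite /= inordK.
  have oE i : (o i \in E) = (elt 3 \in E).
    by have [a [b [u abQ]]] := frame_basis i; apply: exch u abQ.
  have [k3|k3] := ltnP k 3; last first.
    by have [a [b [u abQ]]] := ref_row_basis k3; rewrite -(exch _ _ _ _ k3 u abQ).
  by rewrite -(oE (Ordinal k3)); congr (_ \in E); apply: val_inj.
have [e3|e3] := boolP (elt 3 \in E).
  by move/eqP: ET; apply; apply/setP => k; rewrite all3 e3 inE.
by move/eqP: E0; apply; apply/setP => k; rewrite all3 (negPf e3) inE.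
Qed.

End NodalMatroid.

(** * Its realization space *)

Section NodeSpan.
Variables (k : fieldType) (A : comPzRingType) (eta : {rmorphism k -> A}) (u v : A).

Definition node_span (x : A) := exists c b b', x = eta c + (b * u + b' * v).

Lemma node_spanC c : node_span (eta c).
Proof. by exists c, 0, 0; rewrite !mul0r !addr0. Qed.

Lemma node_span_u : node_span u.
Proof. by exists 0, 1, 0; rewrite rmorph0; ring. Qed.

Lemma node_spanD x y : node_span x -> node_span y -> node_span (x + y).
Proof.
move=> [c [b [b' ->]]] [e [a [a' ->]]]; exists (c + e), (b + a), (b' + a').
by rewrite rmorphD; ring.
Qed.

Lemma node_spanM x y : node_span x -> node_span y -> node_span (x * y).
Proof.
move=> [c [b [b' ->]]] [e [a [a' ->]]].
exists (c * e), (b * (eta e + a * u + a' * v) + eta c * a),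
  (b' * (eta e + a * u + a' * v) + eta c * a').
by rewrite rmorphM; ring.
Qed.

Lemma node_spanN x : node_span x -> node_span (- x).
Proof. by move=> Px; rewrite -mulN1r -(rmorphN1 eta); apply/node_spanM/Px/node_spanC. Qed.

(* [m ^ 2 - m + 1] is [3] modulo [u] when [m = 2 + u]. *)
Lemma node_span_solve r : 3 != 0 :> k ->
  v = 1 - (2 + u) - r * ((2 + u) ^+ 2 - (2 + u) + 1) -> node_span r.
Proof.
move=> n3 ev; have three : eta 3^-1 * 3 = 1.
  by rewrite -(rmorph_nat eta 3) -rmorphM mulVf ?rmorph1.
exists (- 3^-1), (- eta 3^-1 * (1 + r * (3 + u))), (- eta 3^-1).
transitivity (eta 3^-1 * 3 * r); first by rewrite three mul1r.
by rewrite rmorphN ev; ring.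
Qed.

Variable phi : {rmorphism A -> node_ring k 0}.
Hypothesis phi_eta : forall c, phi (eta c) = node_const 0 c.
Hypothesis phi_u : phi u = node_u k.
Hypothesis phi_v : phi v = node_v k.

(** If the constant [c] of [x] were zero, then [phi x], and with it [1], would have order 1. So [y]
    is [c^-1 * (1 - (b * u + b' * v) * y)]. *)
Lemma node_spanV x y : x * y = 1 -> node_span x -> node_span y.
Proof.
move=> xy [c [b [b' ex]]].
have c_neq0 : c != 0.
  apply/eqP => cz; have /eqP : (1 : k) = 0; last by rewrite oner_eq0.
  apply: node_const_ord1; rewrite -phi_eta rmorph1 -xy ex cz rmorph0 add0r.
  rewrite rmorphM mulrC; apply: node_ordMl; rewrite rmorphD !rmorphM phi_u phi_v.
  by apply: node_ordD; apply: node_ordMl; [apply: node_u_ord1|apply: node_v_ord1].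
have ccV : eta c^-1 * eta c = 1 by rewrite -rmorphM mulVf // rmorph1.
exists c^-1, (- (eta c^-1 * b * y)), (- (eta c^-1 * b' * y)).
have e : eta c * y = 1 - (b * u + b' * v) * y by rewrite -[X in X - _]xy ex; ring.
transitivity (eta c^-1 * eta c * y); first by rewrite ccV mul1r.
by rewrite -mulrA e; ring.
Qed.

End NodeSpan.

Section NodalRealizationSpace.
Variables (F : numFieldType) (n : nat) (n12 : (12 <= n)%N).
Local Notation Q := (nodal_matroid F n12).
Local Notation A := (realization_ring F Q).
Local Notation N := (node_ring F 0).
Local Notation S := (stratum_ring F Q).
Local Notation U := (@chart_entry F n Q).
Local Notation o := (row_index Q).
Local Notation elt := (elt n12).

Definition node_const_map : {rmorphism F -> N} :=
  [the {rmorphism _ -> _} of node_of F \o @mpolyC 2 F].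

Lemma config_det_unit a b c : special_det a b c != 0 ->
  exists y, config_det (node_u F) (node_v F) a b c * y = 1.
Proof.
move=> d0; pose p : {mpoly F[2]} := config_det 'X_(inord 0) 'X_(inord 1) a b c.
have -> : config_det (node_u F) (node_v F) a b c = node_of F p.
  by rewrite rmorph_config_det.
apply: node_unit (node_of_const_term p).
rewrite (_ : p.@[_] = (special_det a b c)%:~R) ?intr_eq0 //.
rewrite /special_det (rmorph_config_det (intmul 1)) /p.
rewrite (rmorph_config_det (meval (fun=> 0 : F))).
by rewrite /= !mevalXU (rmorph0 (intmul 1)).
Qed.

(** The configuration over the node ring has the minors required by [stratum_lift]: nonbasis minors
    vanish by [uv = 0], and basis minors are units by their constant terms. *)
Lemma node_realization : exists psi : {rmorphism S -> N},
  (forall c, psi (stratum_const F Q c) = node_const 0 c) /\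
  (forall i k, psi (U i k) = config_pt (node_u F) (node_v F) (label k) i).
Proof.
have uv0 := node_uv F.
apply: (stratum_lift node_const_map) => [i k k3|a b c u|a b c u].
- have -> : label k = k by apply/minn_idPl/(leq_trans (ltnW k3)).
  rewrite /config_pt; case: (k : nat) k3 => [|[|[|//]]] _;
    by case: i => [[|[|[|//]]] hi].
- rewrite nodal_matroidE // negbK => /eqP d0.
  exact: (config_det_eq0 uv0 (label_lt _) (label_lt _) (label_lt _) d0).
rewrite nodal_matroidE //; exact: config_det_unit.
Qed.

Lemma chart_ref_unit (k : 'I_n) : exists y, U (ref_row k) k * y = 1.
Proof.
have [k3|k3] := ltnP k 3; last first.
  by have [a [b [u abQ]]] := ref_row_basis F n12 k3; apply: chart_entry_unit k3 u abQ.
have -> : k = o (Ordinal k3) by apply: val_inj.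
exists 1; rewrite ref_row_row chart_entry_initial; last exact: (ltn_ord (Ordinal k3)).
by rewrite eqxx mulr1.
Qed.

Lemma chart_frame_unit i : exists y, U i (elt 3) * y = 1.
Proof.
have [a [b [u abQ]]] := frame_basis F n12 i.
by apply: chart_entry_unit u abQ; rewrite /= inordK.
Qed.

Lemma special_lines_valid t : t \in special_lines ->
  [/\ (t.1.1 < 12)%N, (t.1.2 < 12)%N, (t.2 < 12)%N, uniq [:: t.1.1; t.1.2; t.2]
    & special_det t.1.1 t.1.2 t.2 == 0].
Proof.
have /allP h : all (fun t => [&& (t.1.1 < 12)%N, (t.1.2 < 12)%N, (t.2 < 12)%N,
    uniq [:: t.1.1; t.1.2; t.2] & special_det t.1.1 t.1.2 t.2 == 0]) special_lines.
  by vm_compute.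
by move=> /h /and5P.
Qed.

Lemma nodal_realization_space :
  has_nodal_singularities [the {rmorphism F -> _} of @realization_const F 3 n Q].
Proof.
have [Y [YI [Y3 Yref] Y0 YU [Yval Ygen]]] :=
  normal_form (@ref_row_row F n n12) chart_ref_unit chart_frame_unit.
have [psi [psiC psiU]] := node_realization.
pose y j i := Y i (elt j).
have yaff j i : (j < 12)%N -> ref_row (elt j) = i -> y j i = 1.
  by move=> j12 <-; apply: Yref.
have yline t : t \in special_lines -> det3 (y t.1.1) (y t.1.2) (y t.2) = 0.
  case/special_lines_valid => a12 b12 c12 u /eqP d0.
  have ue := elt_uniq n12 a12 b12 c12 u.
  by apply: (Y0 _ _ _ ue); rewrite nodal_matroidE // !label_elt // d0 eqxx.
have yunit a b c : (a < 12)%N -> (b < 12)%N -> (c < 12)%N -> uniq [:: a; b; c] ->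
    special_det a b c != 0 -> exists w, det3 (y a) (y b) (y c) * w = 1.
  move=> a12 b12 c12 u d0; have ue := elt_uniq n12 a12 b12 c12 u.
  by apply: (YU _ _ _ ue); rewrite nodal_matroidE // !label_elt.
(* These are the minors [- r] and [1 - r - m]. *)
have [w hw] := yunit 0 3 6 isT isT isT isT isT.
have [w' hw'] := yunit 1 7 8 isT isT isT isT isT.
have y_init j i : (j < 3)%N -> y j i = (j == i)%:R.
  move=> j3; have ej : elt j = j :> nat by rewrite /= inordK // (ltn_trans j3).
  by rewrite /y YI ej.
have refE j : (j < 12)%N -> ref_row (elt j) =
    if j \in [:: 0; 4] then r0 else if j \in [:: 1; 5] then r1 else r2.
  by move=> j12; rewrite /ref_row label_elt.
have y4 : y 4 r0 = 1 by apply: yaff; rewrite ?refE.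
have y5 : y 5 r1 = 1 by apply: yaff; rewrite ?refE.
have yaff6 j : (6 <= j < 12)%N -> y j r2 = 1.
  case/andP=> j6 j12; apply: yaff; rewrite ?refE //.
  by case: j j6 {j12} => [|[|[|[|[|[|]]]]]].
have [m [r [h [ypt c1 [d hd] uv0]]]] :=
  solve_configuration y_init Y3 y4 y5 yaff6 yline hw hw'.
have Ypt i k : Y i k = normal_pt m r h (label k) i.
  have [k12|k12] := ltnP k 12.
    by rewrite -ypt ?label_lt // /y elt_label.
  have lk : label k = 11 by apply/minn_idPr/ltnW.
  have kel j : (j < 12)%N -> (k == elt j) = false.
    by move=> j12; rewrite -val_eqE /= inordK // gtn_eqF // (leq_trans j12 k12).
  (* An element [k] past number 11 is parallel to [elt 11]. Both columns have last coordinate [1],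
     so the minors with points 1 and 0 identify their first and second coordinates. *)
  have par j : (j < 11)%N -> det3 (Y^~ k) (Y^~ (elt 11)) (Y^~ (elt j)) = 0.
    move=> j11; have j12 := ltnW j11 : (j < 12)%N.
    have u : uniq [:: k; elt 11; elt j].
      by rewrite /= !inE !kel //= andbT -val_eqE /= !inordK // gtn_eqF.
    apply: (Y0 _ _ _ u); rewrite nodal_matroidE // lk !label_elt //.
    by rewrite /special_det /config_det det3_eq12 eqxx.
  have Yk2 : Y r2 k = 1 by rewrite -(Yref k) /ref_row lk.
  have Y11 : Y r2 (elt 11) = 1 by rewrite -[LHS]/(y 11 r2) yaff6.
  have Ykc j i' : (j < 3)%N -> Y i' (elt j) = (j == i')%:R by exact: y_init.
  rewrite lk -ypt // -[RHS]/(Y i (elt 11)).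
  have e0 := par 0 isT; have e1 := par 1 isT.
  rewrite /det3 /= !(Ykc 0%N _ isT) Yk2 Y11 /= in e0.
  rewrite /det3 /= !(Ykc 1%N _ isT) Yk2 Y11 /= in e1.
  case: i => [[|[|[|//]]] hi].
  - rewrite (_ : Ordinal hi = r0); last exact: val_inj.
    by apply: subr0_eq; rewrite -[RHS]oppr0 -e1; ring.
  - rewrite (_ : Ordinal hi = r1); last exact: val_inj.
    by apply: subr0_eq; rewrite -e0; ring.
  - rewrite (_ : Ordinal hi = r2); last exact: val_inj.
    by rewrite Yk2 Y11.
pose u := m - 2; pose v := (1 - m) - r * (m ^+ 2 - m + 1).
(* Under [psi] the normalized coordinates become those of the configuration divided by the reference
   entries, here with denominators cleared. *)
have psi_pt i j : (j < 12)%N -> psi (\val (y j i)) *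
    (config_pt (node_u F) (node_v F) j (ref_row (elt j)) * config_pt (node_u F) (node_v F) 3 i)
    = config_pt (node_u F) (node_v F) 3 (ref_row (elt j))
      * config_pt (node_u F) (node_v F) j i.
  move=> j12; have := congr1 psi (Yval i (elt j)).
  rewrite [LHS]rmorphM [psi (U _ _ * U i _)]rmorphM [psi (U _ (elt 3) * _)]rmorphM.
  by rewrite !psiU !label_elt.
pose phi : {rmorphism A -> N} := [the {rmorphism _ -> _} of psi \o (\val : A -> S)].
have phi_m : phi m = 2 + node_u F.
  have -> : m = y 5 r0 by rewrite ypt.
  have := psi_pt r0 5 isT; rewrite refE // /config_pt /= -[psi _]/(phi _).
  by rewrite !mul1r mulr1.
(* [D] is the last coordinate of point 6 and also [m ^+ 2 - m + 1] at [m = 2 + u]; this makes [v]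
   map to [node_v]. *)
pose D : N := 3 + 3 * node_u F + node_u F ^+ 2.
have phi_r : (1 + phi r) * D = 2 + 2 * node_u F + node_u F ^+ 2 - node_v F.
  have -> : 1 + phi r = phi (y 6 r1) by rewrite ypt // rmorphD rmorph1.
  have := psi_pt r1 6 isT; rewrite refE // /config_pt /= -[psi _]/(phi _).
  by rewrite mulr1 mul1r.
have phi_u : phi u = node_u F by rewrite rmorphB phi_m rmorph_nat addrC addKr.
have phi_v : phi v = node_v F.
  rewrite /v !rmorphB rmorphM rmorphD rmorphB rmorphXn rmorph1 phi_m.
  transitivity (- (node_u F) - 1 - ((1 + phi r) * D - D)); first by rewrite /D; ring.
  by rewrite phi_r /D; ring.
pose c0 : {rmorphism F -> A} := [the {rmorphism _ -> _} of @realization_const F 3 n Q].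
have phi_c c : phi (c0 c) = node_const 0 c by apply: psiC.
pose P := node_span c0 u v.
have PC c : P (c0 c) by apply: node_spanC.
have PD x x' : P x -> P x' -> P (x + x') by apply: node_spanD.
have PM x x' : P x -> P x' -> P (x * x') by apply: node_spanM.
have PI x x' : x * x' = 1 -> P x -> P x' by apply: (node_spanV phi_c phi_u phi_v).
have PN x : P x -> P (- x) by apply: node_spanN.
have P1 : P 1 by rewrite -(rmorph1 c0); apply: (PC).
have mE : m = c0 2 + u by rewrite rmorph_nat /u addrC subrK.
have Pm : P m by rewrite mE; apply: (PD); [apply: (PC)|apply: node_span_u].
have Pr : P r.
  apply: (@node_span_solve _ _ c0 u v r); first by rewrite pnatr_eq0.
  by rewrite /v mE rmorph_nat.
(* The equation [c1] is solved for [h] with the inverse [d] of [1 - r - m]. *)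
have Ph : P h.
  have -> : h = 1 + r - r * (1 - m - m * r) * d.
    by rewrite -c1 -mulrA hd mulr1 opprB addrC subrK.
  apply: (PD); first exact: PD.
  apply: (PN); apply: (PM); last first.
    by apply: (PI _ _ hd); apply: (PD); [apply: (PD) => //|]; apply: (PN).
  by apply: (PM) => //; apply: (PD); [apply: (PD) => //|]; apply: (PN) => //; apply: (PM).
have PY i k : P (Y i k).
  rewrite Ypt; have P0 : P 0 by rewrite -(rmorph0 c0); apply: (PC).
  have Pmr : P (m * r) by apply: (PM).
  have P8 : P (1 + m * r - r) by apply: (PD); [apply: (PD)|apply: (PN)].
  have P11 : P (h + m * r - r) by apply: (PD); [apply: (PD)|apply: (PN)].
  have P6 : P (1 + m * r) by apply: (PD).
  have P6' : P (1 + r) by apply: (PD).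
  have P7 : P (m + m * r) by apply: (PD).
  rewrite /normal_pt; move: (label k) (label_lt k) => j.
  by case: i => [[|[|[|//]]] hi] /=; do 12![case: j => [|j] //=].
have gen x : P x by apply: Ygen x.
exact: (@node_criterion F A c0 u v phi uv0 gen phi_c phi_u phi_v).
Qed.

End NodalRealizationSpace.

Theorem theorem1p2 (R : realType) (n : nat) (hn : (12 <= n)%N) :
  exists Q : matroid 3 n,
    [/\ connected_matroid Q, realizable R[i] Q & realization_space_nodal R[i] Q].
Proof.
exists (nodal_matroid R[i] hn); split.
- exact: nodal_matroid_connected.
- exact: column_matroid_realizable.
(* The first three points already form a basis, so the identity relabelling serves. *)
exists 1%g; rewrite relabel1; first exact: initial_basis.
exact: nodal_realization_space.
Qed.
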